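(* Let $M\in\operatorname{Mat}_n(\mathbb{C})$ be a nonzero matrix and let $\nu$ be the largest size of a Jordan block of $M$ associated to the eigenvalue $0$ (with $\nu=0$ if $0$ is not an eigenvalue of $M$). Let $X=\{M^k\mid k\in\mathbb{Z}_{>0}\}$ be the semigroup generated by $M$, and let $\overline{X}$ be its Zariski closure in $\operatorname{Mat}_n(\mathbb{C})$. Let $\mathcal{E}(M)$ be the set of nonzero eigenvalues of $M$ and, if $\mathcal{E}(M)\neq\varnothing$, let $G(M)$ be the subgroup of $\mathbb{C}^*$ generated by $\mathcal{E}(M)$. Then $\overline{X}$ can be written as a disjoint union $\overline{X}=X_0\,\dot\cup\,X_1$ of Zariski closed sets such that: (1) $X_0$ is a finite set of points, of cardinality $\nu$ if $\mathcal{E}(M)=\varnothing$, and of cardinality $\max\{0,\nu-1\}$ otherwise; (2) either $X_1=\mathcal{E}(M)=\varnothing$, or $X_1$ is a union of $|G(M)_{\mathrm{tor}}|$ toric varieties of dimension $$\dim X_1=\begin{cases}\operatorname{rk} G(M) & \text{if } M^{\max\{1,\nu\}} \text{ is diagonalizable},\\ \operatorname{rk} G(M)+1 & \text{otherwise.}\end{cases}$$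
   Context: $\operatorname{Mat}_n(\mathbb{C})$ is regarded as the affine space $\mathbb{C}^{n^2}$, and Zariski closures are taken in it. For a finitely generated abelian group $G$, $G_{\mathrm{tor}}$ denotes its torsion subgroup and $\operatorname{rk} G$ the rank of a free complement of $G_{\mathrm{tor}}$ in $G$; $|\cdot|$ denotes the order of a finite group. Toric varieties are affine and not assumed normal: for lattice points $\alpha_1,\dots,\alpha_m\in\mathbb{Z}^r$, let $Y_{\mathcal{A}}\subseteq\mathbb{C}^m$ be the Zariski closure of the image of the monomial map $(\mathbb{C}^* )^r\to(\mathbb{C}^* )^m$, $x\mapsto(x^{\alpha_1},\dots,x^{\alpha_m})$, where $x^{\alpha_i}=x_1^{\alpha_{i1}}\cdots x_r^{\alpha_{ir}}$. A variety is called toric if it is isomorphic to some $Y_{\mathcal{A}}$ (equivalently, it is an irreducible affine variety containing an algebraic torus as a Zariski open subset such that the action of the torus on itself extends to an algebraic action on the variety). *)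

(* Defs.v *)
From HB Require Import structures.
From mathcomp Require Export all_boot all_order all_algebra.
From mathcomp Require Export boolp classical_sets functions cardinality reals.
From mathcomp Require Export complex mpoly.

Set Implicit Arguments.
Unset Strict Implicit.
Unset Printing Implicit Defensive.

Import Order.TTheory GRing.Theory Num.Theory.

Local Open Scope ring_scope.
Local Open Scope classical_set_scope.

Section AffineGeometry.
Context {F : fieldType}.

(* 'M_(p, q) is the affine space F^(pq), its coordinates being the p * q matrix
   entries enumerated by mxvec; F^m is 'rV_m. *)
Definition eval_mx p q (f : {mpoly F[p * q]}) (A : 'M[F]_(p, q)) : F :=
  f.@[fun i => mxvec A 0 i].

Definition zariski_closed p q (Z : set 'M[F]_(p, q)) : Prop :=
  exists S : set {mpoly F[p * q]},
    Z = [set A | forall f, S f -> eval_mx f A = 0].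

Definition zariski_closure p q (X : set 'M[F]_(p, q)) : set 'M[F]_(p, q) :=
  smallest (@zariski_closed p q) X.

Definition irreducible_closed p q (Z : set 'M[F]_(p, q)) : Prop :=
  [/\ zariski_closed Z, Z !=set0 &
      forall A B : set 'M[F]_(p, q), zariski_closed A -> zariski_closed B ->
        Z `<=` A `|` B -> Z `<=` A \/ Z `<=` B].

Definition irreducible_chain p q (Z : set 'M[F]_(p, q)) (d : nat)
    (c : nat -> set 'M[F]_(p, q)) : Prop :=
  (forall i, (i <= d)%N -> irreducible_closed (c i) /\ c i `<=` Z) /\
  (forall i, (i < d)%N -> c i `<` c i.+1).

(* Krull dimension; no d qualifies when Z is empty. *)
Definition has_dim p q (Z : set 'M[F]_(p, q)) (d : nat) : Prop :=
  (exists c, irreducible_chain Z d c) /\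
  (forall e c, irreducible_chain Z e c -> (e <= d)%N).

Definition poly_map p q p' q' (f : 'M[{mpoly F[p * q]}]_(p', q'))
    (A : 'M[F]_(p, q)) : 'M[F]_(p', q') :=
  \matrix_(i, j) eval_mx (f i j) A.

Definition isomorphic p q p' q'
    (Z : set 'M[F]_(p, q)) (Y : set 'M[F]_(p', q')) : Prop :=
  exists (f : 'M[{mpoly F[p * q]}]_(p', q'))
         (g : 'M[{mpoly F[p' * q']}]_(p, q)),
    [/\ forall x, Z x -> Y (poly_map f x),
        forall y, Y y -> Z (poly_map g y),
        forall x, Z x -> poly_map g (poly_map f x) = x &
        forall y, Y y -> poly_map f (poly_map g y) = y].

Definition torus r : set 'rV[F]_r := [set x | forall j, x 0 j != 0].

(* The lattice points are the rows of alpha. *)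
Definition monomial_map m r (alpha : 'M[int]_(m, r)) (x : 'rV[F]_r) :
    'rV[F]_m :=
  \row_i \prod_j x 0 j ^ alpha i j.

Definition toric_model m r (alpha : 'M[int]_(m, r)) : set 'rV[F]_m :=
  zariski_closure (monomial_map alpha @` @torus r).

Definition toric_variety p q (Z : set 'M[F]_(p, q)) : Prop :=
  zariski_closed Z /\
  exists (m r : nat) (alpha : 'M[int]_(m, r)), isomorphic Z (toric_model alpha).

End AffineGeometry.

Section MultiplicativeGroups.
Context {F : fieldType}.

Definition mul_subgroup (H : set F) : Prop :=
  [/\ H 1, forall x, H x -> x != 0,
      forall x y, H x -> H y -> H (x * y) &
      forall x, H x -> H x^-1].

Definition torsion (G : set F) : set F :=
  [set x | G x /\ exists2 k, (0 < k)%N & x ^+ k = 1].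

Definition free_basis (H : set F) r (z : 'I_r -> F) : Prop :=
  H = [set \prod_i z i ^ a i | a in [set: 'I_r -> int]] /\
  forall a : 'I_r -> int, \prod_i z i ^ a i = 1 -> forall i, a i = 0.

Definition group_rank (G : set F) (r : nat) : Prop :=
  exists H : set F,
    [/\ mul_subgroup H, H `<=` G,
        H `&` torsion G = [set 1],
        G = [set t * h | t in torsion G & h in H] &
        exists z : 'I_r -> F, free_basis H z].

End MultiplicativeGroups.

Section Spectrum.
Context {F : fieldType}.

Definition jordan_block k (a : F) : 'M[F]_k :=
  \matrix_(i, j) (a *+ (i == j) + (i.+1 == j :> nat)%:R).

(* The total block size \sum_i k i is n only propositionally, so similarity goes
   through a pair of mutually inverse rectangular matrices. *)
Definition jordan_form n (M : 'M[F]_n) m (k : 'I_m -> nat) (a : 'I_m -> F) :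
    Prop :=
  (forall i, (0 < k i)%N) /\
  exists (P : 'M[F]_(n, \sum_i k i)) (Q : 'M[F]_(\sum_i k i, n)),
    [/\ P *m Q = 1%:M, Q *m P = 1%:M &
        M = P *m (\mxdiag_i jordan_block (k i) (a i)) *m Q].

Definition has_jordan_block n (M : 'M[F]_n) (b : F) (s : nat) : Prop :=
  exists m (k : 'I_m -> nat) (a : 'I_m -> F),
    jordan_form M k a /\ exists i, k i = s /\ a i = b.

(* A block of an n x n matrix has size at most n, so the range of the maximum
   loses nothing; it is 0 when no block belongs to b. *)
Definition max_jordan_size n (M : 'M[F]_n) (b : F) : nat :=
  \max_(s < n.+1 | `[< has_jordan_block M b s >]) s.

Definition nonzero_eigenvalues n (M : 'M[F]_n) : set F :=
  [set a | eigenvalue M a /\ a != 0].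

Definition eigenvalue_group n (M : 'M[F]_n) : set F :=
  smallest mul_subgroup (nonzero_eigenvalues M).

Definition power_semigroup n (M : 'M[F]_n) : set 'M[F]_n :=
  [set M ^+ k | k in [set k | (0 < k)%N]].

End Spectrum.

(* Main.v *)
Require Import Defs.
From mathcomp Require Import cyclic separable cyclotomic ring zify.

(** Over the algebraically closed field R[i], a Jordan decomposition of M shows
    that for k >= nu the power M^k is a combination, with linearly independent
    matrix coefficients D c, of exponential monomials lam_c^k k^(e_c), lam_c
    running over the nonzero eigenvalues.  The group G(M) is generated by a root
    of unity w of order t = |G(M)_tor| and by r multiplicatively independent
    elements z_j, so lam_c = w^(s_c) z^(a_c).  On a residue class of exponents
    modulo t the factors w^(s_c k) are constant and M^k becomes a monomial
    expression in (z_1^k, ..., z_r^k, k).  As exponential polynomials over distinct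
    bases are linearly independent, these points are Zariski dense in the torus,
    and the closure of the residue class is linearly isomorphic to the closure of a
    monomial image of a torus of dimension r, or r + 1 when some e_c is positive,
    i.e. when a nonzero eigenvalue has a nontrivial Jordan block.

    The dimension is bounded above by counting: a chain of irreducible closed sets
    of length d produces d algebraically independent functions, whereas more than
    r (+1) Laurent polynomials in r (+1) variables are dependent because there are
    fewer monomials than products of them.  It is bounded below by the closures of
    the images of coordinate subtori. *)

Set Implicit Arguments.
Unset Strict Implicit.
Unset Printing Implicit Defensive.
Import Order.TTheory GRing.Theory Num.Theory.
Local Open Scope ring_scope.
Local Open Scope classical_set_scope.
Local Open Scope card_scope.

(** * Polynomial functions and the Zariski topology *)

Section PolynomialFunctions.
Context {F : fieldType}.
Variables p q : nat.
Implicit Types (phi psi : 'M[F]_(p, q) -> F) (X Y Z : set 'M[F]_(p, q)).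

Definition polyfun phi := exists f : {mpoly F[p * q]}, phi = eval_mx f.

Lemma polyfun_const c : polyfun (fun=> c).
Proof. by exists c%:MP; apply/funext => A; rewrite /eval_mx mevalC. Qed.

Lemma polyfun_entry i j : polyfun (fun A => A i j).
Proof.
exists 'X_(mxvec_index i j).
by apply/funext => A; rewrite /eval_mx mevalXU mxvecE.
Qed.

Lemma polyfunD phi psi : polyfun phi -> polyfun psi ->
  polyfun (fun A => phi A + psi A).
Proof.
by move=> [f ->] [g ->]; exists (f + g); apply/funext => A; rewrite /eval_mx mevalD.
Qed.

Lemma polyfunM phi psi : polyfun phi -> polyfun psi ->
  polyfun (fun A => phi A * psi A).
Proof.
by move=> [f ->] [g ->]; exists (f * g); apply/funext => A; rewrite /eval_mx mevalM.
Qed.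

Lemma polyfun_sum (I : Type) (r : seq I) (phi_ : I -> 'M[F]_(p, q) -> F) :
  (forall i, polyfun (phi_ i)) -> polyfun (fun A => \sum_(i <- r) phi_ i A).
Proof.
move=> h; elim: r => [|i r IH].
  by under eq_fun do rewrite big_nil; exact: polyfun_const.
by under eq_fun do rewrite big_cons; exact: polyfunD.
Qed.

Lemma polyfun_prod (I : Type) (r : seq I) (P : pred I)
    (phi_ : I -> 'M[F]_(p, q) -> F) :
  (forall i, polyfun (phi_ i)) -> polyfun (fun A => \prod_(i <- r | P i) phi_ i A).
Proof.
move=> h; elim: r => [|i r IH].
  by under eq_fun do rewrite big_nil; exact: polyfun_const.
case: (boolP (P i)) => Pi.
  by under eq_fun do rewrite big_cons Pi; exact: polyfunM.
by under eq_fun do rewrite big_cons (negbTE Pi).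
Qed.

Lemma polyfunX phi n : polyfun phi -> polyfun (fun A => phi A ^+ n).
Proof.
move=> h; elim: n => [|n IH]; first exact: polyfun_const.
by under eq_fun do rewrite exprS; exact: polyfunM.
Qed.

Lemma polyfun_meval k (f : {mpoly F[k]}) (v : 'I_k -> 'M[F]_(p, q) -> F) :
  (forall i, polyfun (v i)) -> polyfun (fun A => f.@[v ^~ A]).
Proof.
move=> h; under eq_fun do rewrite mevalE.
apply: polyfun_sum => m; apply: polyfunM; first exact: polyfun_const.
by apply: polyfun_prod => i; exact: polyfunX.
Qed.

(** Equations are handled as functions, which spares choosing a polynomial for each of them. *)
Lemma zariski_closedP X :
  zariski_closed X <->
  exists S : set ('M[F]_(p, q) -> F),
    S `<=` polyfun /\ X = [set A | forall phi, S phi -> phi A = 0].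
Proof.
split=> [[S ->]|[S [Sp ->]]].
  exists (@eval_mx _ p q @` S); split=> [_ [f _ <-]|]; first by exists f.
  apply/seteqP; split=> A /= h; first by move=> _ [f Sf <-]; exact: h.
  by move=> f Sf; apply: h; exists f.
exists [set f | S (eval_mx f)]; apply/seteqP; split=> A /= h; first by move=> f; exact: h.
by move=> phi Sphi; have [f e] := Sp _ Sphi; rewrite e; apply: h; rewrite /= -e.
Qed.

Lemma zariski_closed_bigcap (S : set (set 'M[F]_(p, q))) :
  S `<=` @zariski_closed F p q -> zariski_closed (\bigcap_(Y in S) Y).
Proof.
move=> h; apply/zariski_closedP.
exists [set phi | polyfun phi /\ exists2 Y, S Y & forall A, Y A -> phi A = 0].
split=> [phi []//|]; apply/seteqP; split=> A /= hA.
  by move=> phi [_ [Y SY]]; apply; exact: hA.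
move=> Y SY; have /zariski_closedP[T [Tp YE]] := h _ SY; rewrite YE /= => phi Tphi.
by apply: hA; split; [exact: Tp | exists Y => // B; rewrite YE; exact].
Qed.

Lemma closed_zariski_closure X : zariski_closed (zariski_closure X).
Proof. by apply: zariski_closed_bigcap => Y []. Qed.

Lemma sub_zariski_closure X : X `<=` zariski_closure X.
Proof. exact: sub_smallest. Qed.

Lemma zariski_closure_sub X Y :
  zariski_closed Y -> X `<=` Y -> zariski_closure X `<=` Y.
Proof. by move=> cY XY; apply: smallest_sub. Qed.

Lemma zariski_closureS X Y : X `<=` Y -> zariski_closure X `<=` zariski_closure Y.
Proof.
move=> XY; apply: zariski_closure_sub; first exact: closed_zariski_closure.
by move=> x /XY; exact: sub_zariski_closure.
Qed.

Lemma zariski_closureP X A : zariski_closure X A <->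
  forall phi, polyfun phi -> (forall B, X B -> phi B = 0) -> phi A = 0.
Proof.
split=> [cA phi pphi h|h Y [/zariski_closedP[S [Sp ->]] XY]].
  have cl : zariski_closed [set B | phi B = 0].
    apply/zariski_closedP; exists [set phi]; split=> [_ ->//|].
    by apply/seteqP; split=> B /= h'; [move=> _ ->|exact: h'].
  exact: (zariski_closure_sub cl h cA).
by move=> phi Sphi; apply: h; [exact: Sp|move=> B /XY; exact].
Qed.

Lemma zariski_closure_id X : zariski_closed X -> zariski_closure X = X.
Proof.
move=> cX; apply/seteqP; split; last exact: sub_zariski_closure.
exact: zariski_closure_sub.
Qed.

Lemma zariski_closedU X Y :
  zariski_closed X -> zariski_closed Y -> zariski_closed (X `|` Y).
Proof.
move=> /zariski_closedP[S [Sp XE]] /zariski_closedP[T [Tp YE]].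
apply/zariski_closedP.
exists [set chi | exists phi psi, [/\ S phi, T psi & chi = fun A => phi A * psi A]].
split=> [_ [phi [psi [/Sp ? /Tp ? ->]]]|]; first exact: polyfunM.
apply/seteqP; split=> A /=.
  rewrite XE YE => -[] h _ [phi [psi [Sphi Tpsi ->]]].
    by rewrite (h _ Sphi) mul0r.
  by rewrite (h _ Tpsi) mulr0.
move=> h; rewrite XE YE; apply: contrapT => /not_orP[/existsNP[phi] + /existsNP[psi]].
move=> /not_implyP[Sphi /eqP phi0] /not_implyP[Tpsi /eqP psi0].
have /eqP := h (fun A => phi A * psi A) (ex_intro _ phi (ex_intro _ psi (And3 Sphi Tpsi erefl))).
by rewrite mulf_eq0 (negbTE phi0) (negbTE psi0).
Qed.

Lemma zariski_closed0 : zariski_closed (@set0 'M[F]_(p, q)).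
Proof.
apply/zariski_closedP; exists [set (fun=> 1)]; split=> [_ ->|]; first exact: polyfun_const.
by apply/seteqP; split=> A //= /(_ _ erefl)/eqP; rewrite oner_eq0.
Qed.

Lemma zariski_closed1 (B : 'M[F]_(p, q)) : zariski_closed [set B].
Proof.
apply/zariski_closedP.
exists [set phi | exists i j, phi = fun A : 'M[F]_(p, q) => A i j + - B i j]; split.
  move=> _ [i [j ->]]; apply: polyfunD; [exact: polyfun_entry|exact: polyfun_const].
apply/seteqP; split=> A /= h; first by move=> _ [i [j ->]]; rewrite h subrr.
apply/matrixP => i j; apply/eqP; rewrite -subr_eq0; apply/eqP.
exact: (h (fun A : 'M[F]_(p, q) => A i j - B i j) (ex_intro _ i (ex_intro _ j erefl))).
Qed.

Lemma zariski_closed_bigcup n (Z : 'I_n -> set 'M[F]_(p, q)) :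
  (forall i, zariski_closed (Z i)) -> zariski_closed (\bigcup_i Z i).
Proof.
elim: n Z => [Z _|n IH Z cZ].
  rewrite (_ : \bigcup_i _ = set0); first exact: zariski_closed0.
  by apply/seteqP; split=> // A [[]].
rewrite (_ : \bigcup_i _ = Z ord0 `|` \bigcup_i Z (lift ord0 i)).
  by apply: zariski_closedU => //; exact: IH.
apply/seteqP; split=> A.
  case=> i _; case: (unliftP ord0 i) => [j ->|->]; [by right; exists j|by left].
by case=> [h|[j _ h]]; [exists ord0|exists (lift ord0 j)].
Qed.

Lemma zariski_closureU X Y :
  zariski_closure (X `|` Y) = zariski_closure X `|` zariski_closure Y.
Proof.
apply/seteqP; split.
  apply: zariski_closure_sub.
    by apply: zariski_closedU; exact: closed_zariski_closure.
  by move=> A [] /sub_zariski_closure; [left|right].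
by move=> A [] ; apply: zariski_closureS => B; [left|right].
Qed.

Lemma irreducible_bigcup n (Z : 'I_n -> set 'M[F]_(p, q)) X :
  irreducible_closed X -> (forall i, zariski_closed (Z i)) ->
  X `<=` \bigcup_i Z i -> exists i, X `<=` Z i.
Proof.
move=> [cX [x0 Xx0] irr]; elim: n Z => [Z _ /(_ _ Xx0)[[]]//|n IH Z cZ XZ].
have [||A /XZ[i _]|XZ0|] := irr (Z ord0) (\bigcup_i Z (lift ord0 i)).
- exact: cZ.
- by apply: zariski_closed_bigcup.
- case: (unliftP ord0 i) => [j ->|->]; [by right; exists j|by left].
- by exists ord0.
- move=> h; have [i XZi] := IH (fun i => Z (lift ord0 i)) (fun i => cZ (lift ord0 i)) h.
  by exists (lift ord0 i).
Qed.

Lemma irreducibleP X : irreducible_closed X -> forall phi psi,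
  polyfun phi -> polyfun psi -> (forall A, X A -> phi A * psi A = 0) ->
  (forall A, X A -> phi A = 0) \/ (forall A, X A -> psi A = 0).
Proof.
move=> [_ _ irr] phi psi pphi ppsi h.
have cl (chi : 'M[F]_(p, q) -> F) : polyfun chi -> zariski_closed [set A | chi A = 0].
  move=> pchi; apply/zariski_closedP; exists [set chi]; split=> [_ ->//|].
  by apply/seteqP; split=> B /= h'; [move=> _ ->|exact: h'].
have [A /h/eqP||] := irr _ _ (cl _ pphi) (cl _ ppsi).
- by rewrite mulf_eq0 => /orP[/eqP|/eqP]; [left|right].
- by left.
- by right.
Qed.

(** Irreducibility can be tested on any dense subset, in the form that the polynomial functions on
    it have no zero divisors. *)
Lemma irreducible_closure X : X !=set0 ->
  (forall phi psi, polyfun phi -> polyfun psi ->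
    (forall A, X A -> phi A * psi A = 0) ->
    (forall A, X A -> phi A = 0) \/ (forall A, X A -> psi A = 0)) ->
  irreducible_closed (zariski_closure X).
Proof.
move=> [x0 Xx0] h; split; first exact: closed_zariski_closure.
  by exists x0; exact: sub_zariski_closure.
move=> A B cA cB XAB.
have XAB' x : X x -> A x \/ B x by move=> /sub_zariski_closure; exact: XAB.
have [XA|/existsNP[a /not_implyP[Xa nAa]]] := pselect (X `<=` A).
  by left; apply: zariski_closure_sub.
right; apply: zariski_closure_sub => // b Xb; apply: contrapT => nBb.
move: cA cB => /zariski_closedP[S [Sp AE]] /zariski_closedP[T [Tp BE]].
move: nAa nBb; rewrite AE BE => /existsNP[phi /not_implyP[Sphi nphi]].
move=> /existsNP[psi /not_implyP[Tpsi npsi]].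
have [x /XAB'|/(_ _ Xa)//|/(_ _ Xb)//] := h _ _ (Sp _ Sphi) (Tp _ Tpsi).
by rewrite AE BE => -[/(_ _ Sphi)->|/(_ _ Tpsi)->]; rewrite ?mul0r ?mulr0.
Qed.

End PolynomialFunctions.

Section PolynomialMaps.
Context {F : fieldType}.

Definition polymap p q p' q' (f : 'M[F]_(p, q) -> 'M[F]_(p', q')) :=
  forall i j, polyfun (fun A => f A i j).

Lemma polymapP p q p' q' (f : 'M[F]_(p, q) -> 'M[F]_(p', q')) :
  polymap f -> exists g, poly_map g = f.
Proof.
move=> h; have [g gE] := choice (fun ij : 'I_p' * 'I_q' => h ij.1 ij.2).
exists (\matrix_(i, j) g (i, j)); apply/funext => A; apply/matrixP => i j.
by rewrite !mxE -(gE (i, j)).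
Qed.

Lemma polyfun_comp p q p' q' (f : 'M[F]_(p, q) -> 'M[F]_(p', q')) phi :
  polymap f -> polyfun phi -> polyfun (fun A => phi (f A)).
Proof.
move=> hf [g ->]; rewrite /eval_mx; apply: (@polyfun_meval _ _ _ _ g (fun i A => mxvec (f A) 0 i)).
by move=> k; case/mxvec_indexP: k => i j; under eq_fun do rewrite mxvecE.
Qed.

Lemma polymap_closure p q p' q' (f : 'M[F]_(p, q) -> 'M[F]_(p', q')) X Y :
  polymap f -> (forall A, X A -> Y (f A)) ->
  forall A, zariski_closure X A -> zariski_closure Y (f A).
Proof.
move=> hf XY A /zariski_closureP cA; apply/zariski_closureP => phi pphi h.
by apply: (cA (fun A => phi (f A))); [exact: polyfun_comp|move=> B /XY; exact: h].
Qed.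

End PolynomialMaps.

(** * Dimension and algebraic independence *)

Section AlgebraicIndependence.
Context {F : fieldType}.

(* Indexes the monomials in e variables of degree < N in each of them. *)
Fixpoint box N e : finType := if e is e'.+1 then ('I_N * box N e')%type else unit.

(** The first component of an index is the exponent of the last function, so that adjoining a
    function on top leaves the indices below unchanged. *)
Fixpoint monom N e (g : nat -> F) : box N e -> F :=
  match e with
  | 0 => fun=> 1
  | e'.+1 => fun a => g e' ^+ a.1 * monom g a.2
  end.

Lemma card_box N e : #|box N e| = (N ^ e)%N.
Proof. by elim: e => [|e IH]; rewrite ?card_unit // expnS card_prod card_ord IH. Qed.

Lemma eq_monom N e (g g' : nat -> F) (a : box N e) :
  (forall i, (i < e)%N -> g i = g' i) -> monom g a = monom g' a.
Proof.
elim: e a => //= e IH a gg'; rewrite gg' // IH // => i ie.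
exact/gg'/ltnW.
Qed.

Variables p q : nat.

(** Algebraic independence of the restrictions to [X]; the quantifier over [N] reaches every
    polynomial, since its exponents are bounded. *)
Definition algindep (X : set 'M[F]_(p, q)) e (g : nat -> 'M[F]_(p, q) -> F) :=
  forall N (c : box N e -> F),
    (forall A, X A -> \sum_a c a * monom (g ^~ A) a = 0) -> forall a, c a = 0.

Lemma algindepS X Y e g : X `<=` Y -> algindep X e g -> algindep Y e g.
Proof. by move=> XY Xg N c h; apply: Xg => A /XY; exact: h. Qed.

Lemma polyfun_monom N e (g : nat -> 'M[F]_(p, q) -> F) (a : box N e) :
  (forall i, polyfun (g i)) -> polyfun (fun A => monom (g ^~ A) a).
Proof.
move=> pg; elim: e a => [|e IH] a /=; first exact: polyfun_const.
by apply: polyfunM; [exact: polyfunX|exact: IH].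
Qed.

(* Krull dimension is bounded by transcendence degree: a function vanishing on
   c e but not on c e.+1 is transcendental over functions independent on c e. *)
Lemma irreducible_chain_algindep Z e (c : nat -> set 'M[F]_(p, q)) :
  irreducible_chain Z e c ->
  exists2 g, (forall i, polyfun (g i)) & algindep (c e) e g.
Proof.
elim: e => [|e IH] [cZ cS].
  exists (fun _ _ => 0) => [i|N b h a]; first exact: polyfun_const.
  have [[_ [A cA] _] _] := cZ 0%N isT.
  by have := h _ cA; rewrite (bigD1 a) //= mulr1 big1 ?addr0 // => -[]; case: a.
have [|g pg gi] := IH.
  by split=> i ie; [apply: cZ; exact: leqW|apply: cS; exact: leqW].
have [[cle _ _] _] := cZ e (leqnSn e).
have [irrS _] := cZ e.+1 (leqnn _).
have [sub nsub] := cS e (leqnn _).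
move/existsNP: nsub => [A1 /not_implyP[cA1 ncA1]].
have [h ph [h0 hA1]] : exists2 h, polyfun h & (forall A, c e A -> h A = 0) /\ h A1 != 0.
  move/zariski_closedP: cle => [S [Sp cE]]; move: ncA1; rewrite cE => /existsNP[h].
  move=> /not_implyP[Sh /eqP hA]; exists h; first exact: Sp.
  by split=> // A; apply.
pose g' (i : nat) := if i == e then h else g i.
exists g' => [i|N b hb]; first by rewrite /g'; case: eqP.
(* [S j] is the coefficient of [h ^ j] in the given relation, read as a polynomial in [h]. *)
pose S (j : 'I_N) A := \sum_(a : box N e) b (j, a) * monom (g ^~ A) a.
have pS j : polyfun (S j).
  apply: polyfun_sum => a; apply: polyfunM; first exact: polyfun_const.
  exact: polyfun_monom.
have hb' A : c e.+1 A -> \sum_(j < N) h A ^+ j * S j A = 0.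
  move=> cA; rewrite -[RHS](hb A cA) /S; under eq_bigr do rewrite mulr_sumr.
  rewrite pair_big /=; apply: eq_bigr => -[j a] _ /=.
  rewrite /g' eqxx mulrCA; congr (_ * (_ * _)).
  by apply: eq_monom => i ie; rewrite (ltn_eqF ie).
(* These coefficients are shown to vanish on [c e] from the lowest power of [h] upwards;
   independence of [g] there then kills [b (j, _)]. *)
suff b0 : forall m (j : 'I_N), (j < m)%N -> forall a, b (j, a) = 0.
  by case=> j a; exact: (b0 N).
elim=> // m IHm j; rewrite ltnS leq_eqVlt => /predU1P[jm|]; last exact: IHm.
apply: gi => A0 cA0.
(* [Q] is the relation divided by [h ^ j]. As [h] does not vanish identically on the irreducible
   [c e.+1], [Q] does; on [c e], where [h] is zero, only [S j] survives of it. *)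
pose Q A := \sum_(l : 'I_N) (if (j <= l)%N then h A ^+ (l - j) * S l A else 0).
have pQ : polyfun Q.
  apply: polyfun_sum => l; case: leqP => _; last exact: polyfun_const.
  by apply: polyfunM => //; exact: polyfunX.
have Sl0 (l : 'I_N) A : (l < j)%N -> S l A = 0.
  by move=> lj; rewrite /S big1 // => a _; rewrite IHm ?mul0r // -jm.
have hQ A : c e.+1 A -> h A ^+ j * Q A = 0.
  move=> cA; rewrite -[RHS](hb' A cA) mulr_sumr; apply: eq_bigr => l _.
  by case: leqP => lj; [rewrite mulrA -exprD subnKC|rewrite Sl0 // !mulr0].
have [/(_ _ cA1)/eqP|/(_ _ (sub _ cA0))] := irreducibleP irrS (polyfunX j ph) pQ hQ.
  by rewrite expf_eq0 (negbTE hA1) andbF.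
rewrite /Q (bigD1 j) //= leqnn subnn mul1r big1 ?addr0 // => l lj.
case: leqP => // jl; rewrite h0 // expr0n subn_eq0 leqNgt ltn_neqAle jl eq_sym.
by rewrite val_eqE lj mul0r.
Qed.

End AlgebraicIndependence.

(** * Jordan decomposition *)

Section JordanDecomposition.
Context {F : fieldType}.

(** The columns of [bP] are a basis of the summand of one block and the rows of [bQ] the dual basis.
    Keeping them block by block avoids matrices whose size is the sum of the block sizes. *)
Record jblock n := JBlock {
  bsize : nat;
  beig : F;
  bP : 'M[F]_(n, bsize);
  bQ : 'M[F]_(bsize, n) }.

Definition jmx n (b : jblock n) : 'M[F]_(bsize b) := jordan_block (bsize b) (beig b).

Definition jordan_dec n (M : 'M[F]_n) m (B : 'I_m -> jblock n) :=
  [/\ forall i, (0 < bsize (B i))%N,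
      forall i, bQ (B i) *m bP (B i) = 1%:M,
      forall i j, i != j -> bQ (B i) *m bP (B j) = 0,
      \sum_i bP (B i) *m bQ (B i) = 1%:M &
      M = \sum_i bP (B i) *m jmx (B i) *m bQ (B i)].

(** The matrix is anti-triangular with the nonzero entry [h k.-1] along the antidiagonal, so the
    coordinates of a row in its kernel vanish one after the other. *)
Lemma hankel_unit k (h : nat -> F) :
  (forall m, (k <= m)%N -> h m = 0) -> h k.-1 != 0 ->
  (\matrix_(i < k, j < k) h (i + j)%N) \in unitmx.
Proof.
move=> h0 hk; rewrite -row_free_unit; apply: inj_row_free => x xH.
have x0 : forall m (i : 'I_k), (i < m)%N -> x 0 i = 0.
  elim=> // m IH i; rewrite ltnS leq_eqVlt => /predU1P[im|/IH//].
  have ij : (k.-1 - i < k)%N by have := ltn_ord i; lia.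
  have /matrixP/(_ 0 (Ordinal ij)) := xH; rewrite !mxE (bigD1 i) //= big1 ?addr0.
    rewrite mxE /= (_ : (i + (k.-1 - i))%N = k.-1); last by have := ltn_ord i; lia.
    by move/eqP; rewrite mulf_eq0 (negbTE hk) orbF => /eqP.
  move=> l li; rewrite mxE /=; have [lti|lei] := ltnP l i.
    by rewrite IH ?mul0r -?im.
  rewrite h0 ?mulr0 //; have := ltn_ord i.
  by move: li; rewrite -val_eqE /=; lia.
by apply/rowP => i; rewrite mxE (x0 k).
Qed.

Lemma jordan_block_mul k n (a : F) (W : 'M[F]_(k, n)) (i : 'I_k) j :
  (jordan_block k a *m W) i j =
  a * W i j + (if insub i.+1 is Some i' then W i' j else 0).
Proof.
rewrite mxE; under eq_bigr do rewrite mxE mulrDl; rewrite big_split /=; congr (_ + _).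
  by rewrite (bigD1 i) //= eqxx big1 ?addr0 // => l /negbTE; rewrite eq_sym => ->; rewrite mul0r.
case: insubP => [i' _ i'E|ki]; last first.
  by rewrite big1 // => l _; case: eqP => [e|]; [rewrite e ltn_ord in ki|rewrite mul0r].
rewrite (bigD1 i') //= i'E eqxx mul1r big1 ?addr0 // => l.
by rewrite -val_eqE /= i'E eq_sym => /negbTE ->; rewrite mul0r.
Qed.

Lemma jordan_blockE k (a : F) : jordan_block k a = jordan_block k 0 + a%:M.
Proof. by apply/matrixP => i j; rewrite !mxE mul0rn add0r addrC. Qed.

(** Multiplication by [N] shifts the Krylov rows by one and sends the last one to [v *m N ^+ k],
    which is zero. *)
Lemma jordan_chain_mul n (N : 'M[F]_n) (v : 'rV[F]_n) k :
  v *m N ^+ k = 0 ->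
  (\matrix_(i < k) (v *m N ^+ i)) *m N =
    jordan_block k 0 *m (\matrix_(i < k) (v *m N ^+ i)).
Proof.
move=> vN; apply/matrixP => i j; rewrite jordan_block_mul mul0r add0r.
have -> : ((\matrix_(i < k) (v *m N ^+ i)) *m N) i j = (v *m N ^+ i.+1) 0 j.
  rewrite exprSr -mulmxE mulmxA !mxE; apply: eq_bigr => l _.
  by rewrite (mxE _ _ i l).
case: insubP => [i' _ i'E|ki]; first by rewrite (mxE _ _ i' j) i'E.
by rewrite (_ : i.+1 = k) ?vN ?mxE //; have := ltn_ord i; lia.
Qed.

(* A row v and a column c killed by N^(k+1), N = M - a, with v N^k c != 0 make
   the product W C of their Krylov matrices an invertible Hankel matrix; the row
   space of W and the kernel of C are then complementary and stable under M.
   They exist because q^2 (X - a)^k is not a multiple of the minimal polynomial. *)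
Lemma jordan_split n (M : 'M[F]_n.+1) (a : F) k (q : {poly F}) :
  mxminpoly M = q * ('X - a%:P) ^+ k.+1 -> ~~ root q a ->
  exists l (P1 : 'M[F]_(n.+1, k.+1)) (Q1 : 'M[F]_(k.+1, n.+1))
         (P2 : 'M[F]_(n.+1, l)) (Q2 : 'M[F]_(l, n.+1)),
  [/\ (l < n.+1)%N,
      [/\ Q1 *m P1 = 1%:M, Q2 *m P2 = 1%:M, Q1 *m P2 = 0 & Q2 *m P1 = 0],
      P1 *m Q1 + P2 *m Q2 = 1%:M &
      M = P1 *m jordan_block k.+1 a *m Q1 + P2 *m (Q2 *m M *m P2) *m Q2].
Proof.
move=> pE qa; pose N := M - a%:M; pose A := horner_mx M q.
have NE : N = horner_mx M ('X - a%:P) by rewrite rmorphB /= horner_mx_X horner_mx_C.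
have AN0 : A *m N ^+ k.+1 = 0.
  by rewrite /A NE -rmorphXn mulmxE -rmorphM -pE; exact: mx_root_minpoly.
have NA0 : N ^+ k.+1 *m A = 0.
  by rewrite /A NE -rmorphXn mulmxE -rmorphM mulrC -pE; exact: mx_root_minpoly.
have [i0 [j0 ij0]] : exists i j, (A *m N ^+ k *m A) i j != 0.
  apply: contrapT => hn.
  have : horner_mx M (q * ('X - a%:P) ^+ k * q) = 0.
    rewrite !rmorphM rmorphXn /= -NE; apply/matrixP => i j; rewrite [RHS]mxE.
    by apply: contrapT => /eqP ?; apply: hn; exists i, j.
  move/mxminpoly_min; rewrite pE exprSr mulrA mulrC [X in _ %| X]mulrC dvdp_mul2r.
    by rewrite dvdp_XsubCl (negbTE qa).
  apply: mulf_neq0; last by rewrite expf_neq0 // polyXsubC_eq0.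
  by apply: contraNneq qa => ->; rewrite root0.
(* The nonzero entry becomes [v N^k c] for the row [v] and the column [c] extracted from the two
   factors [A]. *)
pose v : 'rV[F]_n.+1 := delta_mx 0 i0 *m A.
pose c : 'cV[F]_n.+1 := A *m delta_mx j0 0.
have vN : v *m N ^+ k.+1 = 0 by rewrite -mulmxA AN0 mulmx0.
have Nc : N ^+ k.+1 *m c = 0 by rewrite mulmxA NA0 mul0mx.
pose h m := (v *m N ^+ m *m c) 0 0.
pose W := \matrix_(i < k.+1) (v *m N ^+ i).
pose C := (\matrix_(i < k.+1) (c^T *m N^T ^+ i))^T.
have trN m : N^T ^+ m = (N ^+ m)^T.
  by elim: m => [|m IH]; rewrite ?expr0 ?trmx1 // exprS IH exprSr -!mulmxE trmx_mul.
have WCE : W *m C = \matrix_(i < k.+1, j < k.+1) h (i + j)%N.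
  apply/matrixP => i j; rewrite [RHS]mxE /h exprD -mulmxE mulmxA -[v *m _ *m _ *m c]mulmxA.
  rewrite [LHS]mxE [RHS]mxE; apply: eq_bigr => l _; rewrite /W /C.
  by rewrite (mxE _ _ i l) [X in _ * X]mxE (mxE _ _ j l) trN -trmx_mul [X in _ * X = _]mxE.
have Hu : W *m C \in unitmx.
  rewrite WCE; apply: hankel_unit => [m /subnKC <-|].
    by rewrite /h exprD -mulmxE !mulmxA vN !mul0mx mxE.
  have -> : h k = (delta_mx (0 : 'I_1) i0 *m (A *m N ^+ k *m A) *m delta_mx j0 (0 : 'I_1)) 0 0.
    by rewrite /h /v /c !mulmxA.
  by rewrite -rowE -colE mxE mxE.
have WN : W *m N = jordan_block k.+1 0 *m W by exact: jordan_chain_mul.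
have NC : N *m C = C *m (jordan_block k.+1 0)^T.
  apply: trmx_inj; rewrite !trmx_mul !trmxK; apply: jordan_chain_mul.
  by rewrite trN -trmx_mul Nc trmx0.
pose H := W *m C; pose P1 := C *m invmx H.
(* The Hankel matrix intertwines the nilpotent block with its transpose; this makes the columns of
   [P1] span an [M]-stable space with matrix [jordan_block k.+1 a]. *)
have JH : jordan_block k.+1 0 *m H = H *m (jordan_block k.+1 0)^T.
  by rewrite /H mulmxA -WN -mulmxA NC mulmxA.
have HJ : invmx H *m jordan_block k.+1 0 = (jordan_block k.+1 0)^T *m invmx H.
  by rewrite -[LHS](mulmxK Hu) -/H -(mulmxA (invmx H)) JH mulKmx.
have WM : W *m M = jordan_block k.+1 a *m W.
  by rewrite jordan_blockE mulmxDl -WN mulmxBr mul_mx_scalar mul_scalar_mx subrK.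
have MP : M *m P1 = P1 *m jordan_block k.+1 a.
  rewrite jordan_blockE mulmxDr /P1 -[in RHS](mulmxA C) HJ !mulmxA -NC mulmxBl mulmxBl.
  by rewrite mul_mx_scalar mul_scalar_mx scalemxAl subrK.
have WP : W *m P1 = 1%:M by rewrite mulmxA mulmxV.
(* The idempotent [E] projects onto the complement and commutes with [M]; its rank factorization
   yields [P2] and [Q2]. *)
pose E := 1%:M - P1 *m W.
have PE : P1 *m W *m E = 0 by rewrite mulmxBr mulmx1 mulmxA -(mulmxA P1) WP mulmx1 subrr.
have EP : E *m P1 = 0 by rewrite mulmxBl mul1mx -mulmxA WP mulmx1 subrr.
have WE : W *m E = 0 by rewrite mulmxBr mulmx1 mulmxA WP mul1mx subrr.
have EE : E *m E = E by rewrite {1}/E mulmxBl PE subr0 mul1mx.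
have ME : M *m E = E *m M.
  rewrite /E mulmxBl mulmxBr mul1mx mulmx1; congr (_ - _).
  by rewrite mulmxA MP -!mulmxA WM.
have [l [P2 [Q2 [lE colI rowI PQ2]]]] : exists l (P2 : 'M_(n.+1, l)) (Q2 : 'M_(l, n.+1)),
    [/\ l = \rank E, forall m, injective (@mulmx _ _ _ m P2),
        forall m, injective ((@mulmx _ m _ _)^~ Q2) & P2 *m Q2 = E].
  exists (\rank E), (col_base E), (row_base E); split=> // [m|m|].
  - exact: row_full_inj (col_base_full E).
  - exact: row_free_inj (row_base_free E).
  - exact: mulmx_base.
exists l, P1, W, P2, Q2.
split=> //.
- rewrite lE ltnNge; apply/negP => rE.
  have Eu : E \in unitmx by rewrite -row_full_unit /row_full eqn_leq rE rank_leq_row.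
  have W0 : W = 0 by rewrite -(mulmxK Eu W) WE mul0mx.
  have /matrixP/(_ 0 0)/eqP := WP.
  by rewrite W0 mul0mx !mxE eqxx eq_sym oner_eq0.
- split=> //.
  + by apply: rowI; apply: colI; rewrite mul1mx -!mulmxA PQ2 mulmxA PQ2 EE.
  + by apply: rowI; rewrite mul0mx -mulmxA PQ2.
  + by apply: colI; rewrite mulmx0 mulmxA PQ2.
- by rewrite PQ2 addrC subrK.
- rewrite !mulmxA PQ2 -[_ *m P2 *m _]mulmxA PQ2 -ME -[M *m E *m E]mulmxA EE.
  by rewrite -MP -[M *m P1 *m W]mulmxA -mulmxDr /E [P1 *m W + _]addrC subrK mulmx1.
Qed.


Definition jblock_lift n l (P : 'M[F]_(n, l)) (Q : 'M[F]_(l, n)) (b : jblock l) :=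
  JBlock (beig b) (P *m bP b) (bQ b *m Q).

End JordanDecomposition.

(** By induction on the size: [jordan_split] removes one block, for a root of the minimal polynomial
    and of size its multiplicity there. *)
Lemma jordan_dec_exists (F : closedFieldType) n (M : 'M[F]_n) :
  exists m (B : 'I_m -> jblock n), jordan_dec M B.
Proof.
elim/ltn_ind: n M => -[_ M|n IH M].
  exists 0%N, (fun _ => JBlock 0 (0 : 'M_(0, 0)) 0); split; do ?[by case].
  - by apply/matrixP => -[].
  - by apply/matrixP => -[].
have [a ra] : exists a, root (mxminpoly M) a.
  by apply/closed_rootP; rewrite size_mxminpoly eqSS -lt0n mxminpoly_nonconstant.
have p0 : mxminpoly M != 0 by exact: monic_neq0 (mxminpoly_monic M).
have [[|k] [q]] := multiplicity_XsubC (mxminpoly M) a; rewrite p0 /= => qa pE.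
  by move: ra; rewrite pE expr0 mulr1 (negbTE qa).
have [l [P1 [Q1 [P2 [Q2 [ln [Q1P1 Q2P2 Q1P2 Q2P1] PQ ME]]]]]] := jordan_split pE qa.
have [m [B [B0 B1 B2 B3 B4]]] := IH _ ln (Q2 *m M *m P2).
pose b0 : jblock n.+1 := JBlock a P1 Q1.
pose B' (i : 'I_m.+1) : jblock n.+1 := oapp (fun j => jblock_lift P2 Q2 (B j)) b0 (unlift ord0 i).
have B'0 : B' ord0 = b0 by rewrite /B' unlift_none.
have B'1 j : B' (lift ord0 j) = jblock_lift P2 Q2 (B j) by rewrite /B' liftK.
exists m.+1, B'; split.
- by move=> i; case: (unliftP ord0 i) => [j|] ->; rewrite ?B'0 ?B'1 /=.
- move=> i; case: (unliftP ord0 i) => [j|] ->; rewrite ?B'0 ?B'1 //=.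
  by rewrite mulmxA -(mulmxA _ Q2) Q2P2 mulmx1.
- move=> i j; case: (unliftP ord0 i) => [i'|] ->; case: (unliftP ord0 j) => [j'|] ->;
    rewrite ?B'0 ?B'1 //=.
  + by rewrite (inj_eq lift_inj) mulmxA -(mulmxA _ Q2) Q2P2 mulmx1; exact: B2.
  + by move=> _; rewrite -mulmxA Q2P1 mulmx0.
  + by move=> _; rewrite mulmxA Q1P2 mul0mx.
- rewrite big_ord_recl B'0 /= -PQ; congr (_ + _).
  under eq_bigr do rewrite B'1 /= mulmxA -(mulmxA P2).
  by rewrite -mulmx_suml -mulmx_sumr B3 mulmx1.
- rewrite big_ord_recl B'0 {1}ME /=; congr (_ + _); rewrite B4.
  under [RHS]eq_bigr do rewrite B'1 /jmx /= mulmxA -!(mulmxA P2).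
  by rewrite mulmx_sumr mulmx_suml; apply: eq_bigr => i _; rewrite !mulmxA.
Qed.

Section JordanForm.
Context {F : fieldType}.

(** Together with the converse below, this relates the blockwise bases to similarity with one
    block-diagonal matrix. *)
Lemma jordan_dec_form n (M : 'M[F]_n) m (B : 'I_m -> jblock n) :
  jordan_dec M B -> jordan_form M (fun i => bsize (B i)) (fun i => beig (B i)).
Proof.
move=> [B0 B1 B2 B3 B4]; split=> //.
exists (\mxrow_i bP (B i)), (\mxcol_i bQ (B i)); split.
- by rewrite mul_mxrow_mxcol.
- rewrite mul_mxcol_mxrow -mxdiagZ; apply: eq_mxblock => i j.
  case: eqVneq => [ij|ij]; last by rewrite B2 // conform_mx_id.
  by move: ij => ij; case: _ / ij; rewrite B1 conform_mx_id.
- by rewrite mul_mxrow_mxdiag mul_mxrow_mxcol.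
Qed.

Lemma jordan_form_dec n (M : 'M[F]_n) m (k : 'I_m -> nat) (a : 'I_m -> F) :
  jordan_form M k a -> exists B : 'I_m -> jblock n,
    jordan_dec M B /\ forall i, bsize (B i) = k i /\ beig (B i) = a i.
Proof.
move=> [k0 [P [Q [PQ QP ME]]]].
exists (fun i => JBlock (a i) (submxrow P i) (submxcol Q i)); split=> //.
have QPij i j : submxcol Q i *m submxrow P j = submxblock (1%:M : 'M_(\sum_i k i)) i j.
  by rewrite -QP -[in RHS](submxcolK Q) -[in RHS](submxrowK P) mul_mxcol_mxrow mxblockK.
have Pr := submxrowK P; have Qr := submxcolK Q.
split=> //=.
- by move=> i; rewrite QPij -mxdiagZ submxblock_diag.
- move=> i j ij; rewrite QPij -mxdiagZ /mxdiag mxblockK.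
  by case: eqVneq ij.
- by rewrite -PQ -[in RHS]Pr -[in RHS]Qr mul_mxrow_mxcol.
- by rewrite {1}ME -[in LHS]Pr -[in LHS]Qr mul_mxrow_mxdiag mul_mxrow_mxcol.
Qed.

End JordanForm.

(** Induction on [k] by Pascal's rule. Where [k < l - i] the subtraction in the exponent is
    truncated, but the binomial coefficient is zero. *)
Lemma jordan_blockX (F : fieldType) s (a : F) k (i l : 'I_s) :
  (jordan_block s a ^+ k) i l =
  if (i <= l)%N then 'C(k, l - i)%:R * a ^+ (k - (l - i)) else 0.
Proof.
elim: k i l => [|k IH] i l.
  rewrite expr0 mxE sub0n expr0 mulr1 bin0n subn_eq0 -val_eqE /= eqn_leq.
  by case: leqP; case: leqP.
rewrite exprS -mulmxE jordan_block_mul IH; case: insubP => [i' _ i'E|si].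
  rewrite IH i'E; have [il|li|il] := ltngtP i l.
  - have [e lE] : exists e, (l = i.+1 + e :> nat)%N by exists (l - i.+1)%N; rewrite subnKC.
    rewrite lE addSnnS addKn -addSnnS addKn binS natrD mulrDl subSS; congr (_ + _).
    have [ek|ke] := ltnP e k; last by rewrite bin_small // !mul0r mulr0.
    by rewrite mulrCA -exprS subnSK.
  - by rewrite mulr0 add0r.
  - by rewrite il subnn addr0 !bin0 !mul1r !subn0 exprS.
rewrite addr0; case: leqP => [il|]; last by rewrite mulr0.
have -> : l = i by apply: val_inj => /=; move: si (ltn_ord l) il; lia.
by rewrite subnn !bin0 !mul1r !subn0 exprS.
Qed.

Lemma jordan_block0X (F : fieldType) s k : (s <= k)%N -> jordan_block s 0 ^+ k = 0 :> 'M[F]_s.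
Proof.
move=> sk; apply/matrixP => i l; rewrite jordan_blockX mxE.
case: leqP => // _; rewrite expr0n subn_eq0 leqNgt.
by rewrite (leq_ltn_trans (leq_subr _ _)) ?(leq_trans (ltn_ord l)) // mulr0.
Qed.

(** The nonzero rows of [w] would be eigenvectors of the nilpotent block for the nonzero value
    [b - a]. *)
Lemma jordan_block_eigen (F : fieldType) s r (a b : F) (w : 'M[F]_(r, s)) :
  w *m jordan_block s a = b *: w -> a != b -> w = 0.
Proof.
move=> wJ ab; have wN : w *m jordan_block s 0 = (b - a) *: w.
  move: wJ; rewrite jordan_blockE mulmxDr mul_mx_scalar => /(canRL (addrK _)) ->.
  by rewrite scalerBl.
have wNX k : w *m jordan_block s 0 ^+ k = (b - a) ^+ k *: w.
  elim: k => [|k IH]; first by rewrite !expr0 scale1r mulmx1.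
  by rewrite !exprSr -mulmxE mulmxA IH -scalemxAl wN scalerA.
have /esym/eqP := wNX s; rewrite jordan_block0X // mulmx0 scaler_eq0.
by case/orP => [|/eqP//]; rewrite expf_eq0 subr_eq0 eq_sym (negbTE ab) andbF.
Qed.

Section JordanDecTheory.
Context {F : fieldType} (n : nat) (M : 'M[F]_n) (m : nat) (B : 'I_m -> @jblock F n).
Hypothesis MB : jordan_dec M B.

Let size_gt0 i : (0 < bsize (B i))%N. Proof. by case: MB. Qed.

Lemma jdec_QP i : bQ (B i) *m bP (B i) = 1%:M. Proof. by case: MB. Qed.

Lemma jdec_QP0 i j : i != j -> bQ (B i) *m bP (B j) = 0.
Proof. by case: MB => _ _ + _ _; apply. Qed.

Lemma jdec_PQ : \sum_i bP (B i) *m bQ (B i) = 1%:M. Proof. by case: MB. Qed.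

Lemma jdec_QX i k : bQ (B i) *m M ^+ k = jmx (B i) ^+ k *m bQ (B i).
Proof.
have QM : bQ (B i) *m M = jmx (B i) *m bQ (B i).
  case: MB => _ B1 B2 _ {1}->; rewrite mulmx_sumr (bigD1 i) //= big1 ?addr0.
    by rewrite !mulmxA B1 mul1mx.
  by move=> j ji; rewrite !mulmxA B2 1?eq_sym // !mul0mx.
elim: k => [|k IH]; first by rewrite !expr0 mulmx1 mul1mx.
by rewrite !exprS -!mulmxE mulmxA QM -mulmxA IH mulmxA.
Qed.

Lemma jdecX k : M ^+ k = \sum_i bP (B i) *m jmx (B i) ^+ k *m bQ (B i).
Proof.
rewrite -[LHS]mul1mx -jdec_PQ mulmx_suml; apply: eq_bigr => i _.
by rewrite -!mulmxA jdec_QX.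
Qed.

Lemma jdec_MP i : M *m bP (B i) = bP (B i) *m jmx (B i).
Proof.
case: MB => _ B1 B2 _ {1}->; rewrite mulmx_suml (bigD1 i) //= big1 ?addr0.
  by rewrite -!mulmxA B1 mulmx1.
by move=> j ji; rewrite -!mulmxA B2 // !mulmx0.
Qed.

Lemma jdec_Q_inj i k (X : 'M[F]_(k, _)) : X *m bQ (B i) = 0 -> X = 0.
Proof. by move=> XQ; rewrite -[X]mulmx1 -jdec_QP mulmxA XQ mul0mx. Qed.

Lemma jdec_size_le i : (bsize (B i) <= n)%N.
Proof. exact: mulmx1_min (jdec_QP i). Qed.

Lemma jdec_eigenvalue a : eigenvalue M a <-> exists i, beig (B i) = a.
Proof.
split=> [/eigenvalueP[v vM v0]|[i <-]].
  apply: contrapT => /forallNP hn; move/eqP: v0; apply.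
  rewrite -[v]mulmx1 -jdec_PQ mulmx_sumr big1 // => i _.
  suff w0 : v *m bP (B i) = 0 by rewrite mulmxA w0 mul0mx.
  apply: (@jordan_block_eigen _ _ _ (beig (B i)) a).
    by rewrite -mulmxA -jdec_MP mulmxA vM scalemxAl.
  by apply/eqP => ba; case: (hn i).
(* The last basis row of a block is a left eigenvector. *)
have ls : ((bsize (B i)).-1 < bsize (B i))%N by rewrite prednK.
pose l := Ordinal ls; pose e : 'rV[F]__ := delta_mx 0 l.
apply/eigenvalueP; exists (e *m bQ (B i)).
  rewrite -mulmxA; have := jdec_QX i 1; rewrite !expr1 => ->; rewrite mulmxA scalemxAl.
  congr (_ *m _); rewrite -rowE; apply/rowP => j; rewrite !mxE eqxx /= eq_sym.
  have -> : (l.+1 == j :> nat) = false.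
    by apply/negbTE; rewrite /= prednK // neq_ltn ltn_ord orbT.
  by rewrite addr0 mulr_natr eq_sym.
apply/eqP => /jdec_Q_inj/matrixP/(_ 0 l)/eqP; rewrite !mxE !eqxx.
by rewrite oner_eq0.
Qed.

(** The first basis row of the block starts a chain of exactly [bsize (B i)] nonzero vectors. *)
Lemma jdec_nil_vector i : beig (B i) = 0 ->
  exists v : 'rV[F]_n, v *m M ^+ bsize (B i) = 0 /\ v *m M ^+ (bsize (B i)).-1 != 0.
Proof.
move=> bi0; have s0 := size_gt0 i.
have ls : ((bsize (B i)).-1 < bsize (B i))%N by rewrite prednK.
pose e : 'rV[F]__ := delta_mx 0 (Ordinal s0).
exists (e *m bQ (B i)); rewrite -!mulmxA !jdec_QX /jmx bi0 jordan_block0X //.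
rewrite mul0mx mulmx0; split=> //; apply/eqP; rewrite mulmxA => /jdec_Q_inj.
move=> /matrixP/(_ 0 (Ordinal ls))/eqP; rewrite -rowE !mxE jordan_blockX /=.
by rewrite subn0 subnn binn expr0 mulr1 oner_eq0.
Qed.

Let nu := (\max_(i | beig (B i) == 0%R) bsize (B i))%N.

Lemma jdec_nil_le i : beig (B i) = 0 -> (bsize (B i) <= nu)%N.
Proof. by move=> bi; apply: (leq_bigmax_cond (F := fun i => bsize (B i))); rewrite bi. Qed.

(** A vector killed by a power of [M] has no component in the blocks of nonzero eigenvalue, which
    are invertible; the nilpotent blocks vanish at the power [nu]. *)
Lemma jdec_nil k (v : 'rV[F]_n) : v *m M ^+ k = 0 -> v *m M ^+ nu = 0.
Proof.
move=> vM; rewrite -[v]mulmx1 -jdec_PQ mulmx_sumr mulmx_suml big1 // => i _.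
rewrite -!mulmxA jdec_QX !mulmxA; have [bi|bi] := eqVneq (beig (B i)) 0.
  by rewrite /jmx bi jordan_block0X ?jdec_nil_le // mulmx0 mul0mx.
suff -> : v *m bP (B i) = 0 by rewrite !mul0mx.
have MPX l : M ^+ l *m bP (B i) = bP (B i) *m jmx (B i) ^+ l.
  elim: l => [|l IH]; first by rewrite !expr0 mulmx1 mul1mx.
  by rewrite !exprS -!mulmxE -mulmxA IH mulmxA jdec_MP -mulmxA.
have : (v *m bP (B i)) *m jmx (B i) ^+ k = 0 by rewrite -mulmxA -MPX mulmxA vM mul0mx.
elim: k {vM} => [|k IH]; first by rewrite expr0 mulmx1.
rewrite exprSr -mulmxE mulmxA => h; apply: IH.
by apply: (@jordan_block_eigen _ _ _ (beig (B i)) 0) => //; rewrite scale0r.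
Qed.

End JordanDecTheory.

(** * Powers as exponential monomials *)

Section NilpotentIndex.
Context {F : fieldType} (n : nat) (M : 'M[F]_n).

(** The maximum ranges over all Jordan forms of [M]. A block of size [s] for 0 in any of them gives
    a vector killed by [M ^+ s] but not by [M ^+ s.-1], and [jdec_nil] for the given decomposition
    then bounds [s]. *)
Lemma jordan_max_size m (B : 'I_m -> jblock n) : jordan_dec M B ->
  max_jordan_size M 0 = (\max_(i | beig (B i) == 0%R) bsize (B i))%N.
Proof.
move=> MB; apply/eqP; rewrite eqn_leq; apply/andP; split.
  apply/bigmax_leqP => s /asboolP[m' [k [a [/jordan_form_dec[B' [MB' BE]] [i [ks ai]]]]]].
  have [ki a0] := BE i.
  have [|v [v0 v1]] := jdec_nil_vector MB' (i := i); first by rewrite a0.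
  rewrite leqNgt; apply/negP => lts; move/eqP: v1; apply.
  move: v0 => /(jdec_nil MB) v0; rewrite ki ks.
  rewrite -(subnKC (m := \max_(i | beig (B i) == 0%R) bsize (B i)) (n := s.-1)).
    by rewrite exprD -mulmxE mulmxA v0 mul0mx.
  by move: lts; case: (val s).
apply/bigmax_leqP => i /eqP bi.
have sn : (bsize (B i) < n.+1)%N by rewrite ltnS (jdec_size_le MB).
apply: (@leq_bigmax_cond _ _ (fun s : 'I_n.+1 => s : nat) (Ordinal sn)); apply/asboolP.
exists m, (fun i => bsize (B i)), (fun i => beig (B i)); split.
  exact: jordan_dec_form.
by exists i.
Qed.

(** One vector whose chain has maximal length tells the first powers of [M] apart and separates them
    from the later ones. Without nilpotent blocks the maximum is 0 and the zero vector serves. *)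
Lemma nilpotent_vector m (B : 'I_m -> jblock n) : jordan_dec M B ->
  exists v : 'rV[F]_n, v *m M ^+ max_jordan_size M 0 = 0 /\
    ((0 < max_jordan_size M 0)%N -> v *m M ^+ (max_jordan_size M 0).-1 != 0).
Proof.
move=> MB; rewrite (jordan_max_size MB).
have [c0|c0] := posnP #|[pred i | beig (B i) == 0]|.
  exists 0; rewrite mul0mx big_pred0 ?ltnn //.
  by move=> i; have := card0_eq c0 i.
have [i bi ->] := eq_bigmax_cond (fun i => bsize (B i)) c0.
have [v [v0 v1]] := jdec_nil_vector MB (eqP bi).
by exists v; split.
Qed.

End NilpotentIndex.

Section BinomialBasis.
Context {F : numFieldType}.

(** This is [a^(-l)] times the binomial polynomial [X choose l]; it turns the entries of the [k]-th
    power of a Jordan block into polynomials in [k] times [a ^ k]. *)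
Definition binpoly (a : F) l : {poly F} :=
  (a ^- l / l`!%:R) *: \prod_(j < l) ('X - (j%:R)%:P).

Lemma size_binpoly a l : a != 0 -> size (binpoly a l) = l.+1.
Proof.
move=> a0; rewrite size_scale ?size_prod_XsubC.
  by rewrite /index_enum -enumT size_enum_ord.
by rewrite mulf_neq0 ?invr_eq0 ?expf_neq0 // pnatr_eq0 -lt0n fact_gt0.
Qed.

Lemma horner_binpoly a l k : a != 0 ->
  (binpoly a l).[k%:R] * a ^+ k = 'C(k, l)%:R * a ^+ (k - l).
Proof.
move=> a0; rewrite hornerZ horner_prod.
have -> : \prod_(j < l) ('X - (j%:R)%:P).[k%:R] = (k ^_ l)%:R :> F.
  elim: l => [|l IH]; first by rewrite big_ord0.
  rewrite big_ord_recr /= IH ffactnSr natrM hornerXsubC.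
  by have [lk|kl] := leqP l k; [rewrite natrB|rewrite ffact_small // !mul0r].
rewrite -bin_ffact natrM.
have [lk|kl] := leqP l k; last by rewrite bin_small // !mul0r mulr0 mul0r.
have f0 : l`!%:R != 0 :> F by rewrite pnatr_eq0 -lt0n fact_gt0.
have -> : a ^+ k = a ^+ l * a ^+ (k - l) by rewrite -exprD subnKC.
have : a ^+ l != 0 by rewrite expf_neq0.
move: (a ^+ l) (a ^+ (k - l)) ('C(k, l)%:R : F) (l`!%:R : F) f0 => x y c f f0 x0.
by field; rewrite f0 x0.
Qed.

Variables (s : nat) (a : F).
Hypothesis a0 : a != 0.

Definition bincoef_mx : 'M[F]_s := \matrix_(l, j) (binpoly a l)`_j.

(** The matrix is triangular with nonzero diagonal because [binpoly a l] has degree exactly [l]. *)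
Lemma bincoef_unit : bincoef_mx \in unitmx.
Proof.
rewrite unitmxE det_trig; last first.
  apply/is_trig_mxP => i j ij; rewrite mxE nth_default //.
  by rewrite size_binpoly.
rewrite unitfE; apply/prodf_neq0 => i _; rewrite mxE.
have -> : (binpoly a i)`_i = lead_coef (binpoly a i) by rewrite lead_coefE size_binpoly.
by rewrite lead_coef_eq0 -size_poly_eq0 size_binpoly.
Qed.

(** The coefficient of [k ^ j] in the [k]-th power of the block divided by [a ^ k]. *)
Definition jordan_coef_mx (j : 'I_s) : 'M[F]_s :=
  \matrix_(r, c) if (r <= c)%N then (binpoly a (c - r))`_j else 0.

Lemma jordan_block_expansion k :
  jordan_block s a ^+ k = \sum_(j < s) (a ^+ k * k%:R ^+ j) *: jordan_coef_mx j.
Proof.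
apply/matrixP => r c; rewrite jordan_blockX summxE.
under eq_bigr do rewrite !mxE.
case: leqP => [rc|_]; last by rewrite big1 // => j _; rewrite mulr0.
rewrite -horner_binpoly // mulrC (@horner_coef_wide _ s); last first.
  by rewrite size_binpoly // (leq_ltn_trans (leq_subr _ _)).
by rewrite mulr_sumr; apply: eq_bigr => j _; rewrite mulrA mulrAC.
Qed.

End BinomialBasis.

Section ExponentialForm.
Context {F : numFieldType} (n : nat) (M : 'M[F]_n) (m : nat) (B : 'I_m -> @jblock F n).
Hypothesis MB : jordan_dec M B.

Let I0 := {i : 'I_m | beig (B i) != 0}.
Let I := {i : I0 & 'I_(bsize (B (val i)))}.
Let mk (i : I0) (j : 'I_(bsize (B (val i)))) : I := existT _ i j.
Let blk (x : I) := B (val (tag x)).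
Let ipos (x : I) : (0 < bsize (blk x))%N. Proof. by case: MB => + _ _ _ _; apply. Qed.

Definition expcoef (x : I) : 'M[F]_n :=
  bP (blk x) *m jordan_coef_mx (beig (blk x)) (tagged x) *m bQ (blk x).

(** The first row of [jordan_coef_mx j] is column [j] of [bincoef_mx], so inverting [bincoef_mx]
    recovers the coefficients from the first row of a block. *)
Definition expdual (x : I) (A : 'M[F]_n) : F :=
  \sum_c invmx (bincoef_mx (bsize (blk x)) (beig (blk x))) (tagged x) c *
    (bQ (blk x) *m A *m bP (blk x)) (Ordinal (ipos x)) c.

Lemma polyfun_expdual x : polyfun (expdual x).
Proof.
apply: polyfun_sum => c; apply: polyfunM; first exact: polyfun_const.
under eq_fun do rewrite mxE.
apply: polyfun_sum => j; apply: polyfunM; last exact: polyfun_const.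
under eq_fun do rewrite mxE.
apply: polyfun_sum => l; apply: polyfunM; first exact: polyfun_const.
exact: polyfun_entry.
Qed.

Lemma exp_sumE (y : I -> F) : \sum_c y c *: expcoef c =
  \sum_(i : I0) bP (B (val i)) *m
    (\sum_(j < bsize (B (val i))) y (mk j) *: jordan_coef_mx (beig (B (val i))) j) *m bQ (B (val i)).
Proof.
under [RHS]eq_bigr => i _.
  rewrite mulmx_sumr mulmx_suml.
  under eq_bigr do rewrite -scalemxAr -scalemxAl.
  over.
by rewrite sig_big_dep; apply: eq_bigr => -[i j] _.
Qed.

Lemma expdualK (y : I -> F) x : expdual x (\sum_c y c *: expcoef c) = y x.
Proof.
case: x => i j; rewrite /expdual exp_sumE.
set D := \sum_(i : I0) _.
pose K (i : I0) := \sum_(j < bsize (B (val i))) y (mk j) *: jordan_coef_mx (beig (B (val i))) j.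
have -> : bQ (blk (mk j)) *m D *m bP (blk (mk j)) = K i.
  rewrite /blk /= /D mulmx_sumr mulmx_suml (bigD1 i) //= [X in _ + X]big1 ?addr0.
    by rewrite !mulmxA (jdec_QP MB) mul1mx -mulmxA (jdec_QP MB) mulmx1.
  move=> l li; rewrite !mulmxA (jdec_QP0 MB) ?mul0mx //.
  by rewrite (inj_eq val_inj) eq_sym.
pose w : 'cV[F]_(bsize (B (val i))) := \col_j y (mk j).
have Kc c : K i (Ordinal (ipos (mk j))) c =
    (bincoef_mx (bsize (B (val i))) (beig (B (val i))) *m w) c 0.
  rewrite summxE mxE; apply: eq_bigr => l _.
  by rewrite !mxE /= subn0 mulrC.
under eq_bigr do rewrite Kc.
have := mulKmx (bincoef_unit (bsize (B (val i))) (valP i)) w.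
by move=> /matrixP/(_ j 0); rewrite !mxE.
Qed.

(** From this exponent on the nilpotent blocks contribute nothing, and the others are expanded by
    [jordan_block_expansion]. *)
Lemma expform k : (max_jordan_size M 0 <= k)%N ->
  M ^+ k = \sum_c (beig (blk c) ^+ k * k%:R ^+ tagged c) *: expcoef c.
Proof.
move=> nuk; rewrite (jdecX MB) exp_sumE.
rewrite (bigID (fun i => beig (B i) != 0)) /= [X in _ + X]big1 ?addr0; last first.
  move=> i; rewrite negbK => /eqP bi; rewrite /jmx bi jordan_block0X ?mulmx0 ?mul0mx //.
  by apply: leq_trans nuk; rewrite (jordan_max_size MB) (jdec_nil_le bi).
rewrite (reindex_omap (val : I0 -> 'I_m) insub) /=; last first.
  by move=> i bi; rewrite insubT.
apply: eq_big => [i|i _]; first by rewrite valK eqxx andbT (valP i).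
by rewrite /jmx (jordan_block_expansion _ (valP i)).
Qed.

End ExponentialForm.

(** In a diagonalizing basis [A - a] is diagonal, and a scalar kills whatever its square kills. *)
Lemma diagonalizable_sqr_ker (F : fieldType) n k (A : 'M[F]_n) (a : F) (W : 'M[F]_(k, n)) :
  diagonalizable A -> W *m (A - a%:M) *m (A - a%:M) = 0 -> W *m (A - a%:M) = 0.
Proof.
case=> P Pu /(diagonalizable_forLR Pu)[d ->]. rewrite mxpoly.conjVmx //.
pose e : 'rV[F]_n := d - const_mx a.
have -> : invmx P *m diag_mx d *m P - a%:M = invmx P *m diag_mx e *m P.
  rewrite /e raddfB /= diag_const_mx mulmxBr mulmxBl mul_mx_scalar -scalemxAl mulVmx //.
  by rewrite scalemx1.
have PVP : P *m invmx P = 1%:M by exact: mulmxV.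
rewrite !mulmxA -[W *m _ *m _ *m P *m invmx P]mulmxA PVP mulmx1.
move/(congr1 (mulmx^~ (invmx P))); rewrite mul0mx -[_ *m P *m invmx P]mulmxA PVP mulmx1.
set V := W *m invmx P => Ve; suff -> : V *m diag_mx e = 0 by rewrite mul0mx.
apply/matrixP => i j; move/matrixP/(_ i j)/eqP: Ve.
rewrite !mul_mx_diag [X in _ -> X = _]mxE [X in X == _ -> _]mxE [X in X * _]mxE.
by rewrite !(mxE _ (fun _ _ => 0)) !mulf_eq0 -orbA orbb => ?; apply/eqP; rewrite mulf_eq0.
Qed.

Section Diagonalizability.
Context {F : numFieldType} (n : nat) (M : 'M[F]_n) (m : nat) (B : 'I_m -> @jblock F n).
Hypothesis MB : jordan_dec M B.

(** In a block of size at least 2 with nonzero eigenvalue [a], the last two basis rows form a chain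
    of length 2 for [M^k - a^k], with coupling [k a^(k-1)], nonzero in characteristic zero; this
    contradicts [diagonalizable_sqr_ker]. Conversely, blocks of size 1 act by scalars and the
    nilpotent ones vanish at the power [k]. *)
Lemma diagonalizable_jdec k : (max_jordan_size M 0 <= k)%N -> (0 < k)%N ->
  diagonalizable (M ^+ k) <-> forall i, beig (B i) != 0 -> bsize (B i) = 1%N.
Proof.
move=> nuk k0; split=> [dM i bi|b1].
  apply/eqP; rewrite eqn_leq; apply/andP; split; last by case: MB.
  rewrite leqNgt; apply/negP => s2.
  set a := beig (B i) in bi *; set s := bsize (B i) in s2 *.
  have s1p : (s.-1 < s)%N by lia.
  have s2p : (s.-2 < s)%N by lia.
  pose e1 : 'rV[F]_s := delta_mx 0 (Ordinal s1p).
  pose e2 : 'rV[F]_s := delta_mx 0 (Ordinal s2p).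
  have e1J : e1 *m jmx (B i) ^+ k = a ^+ k *: e1.
    rewrite -rowE; apply/rowP => -[j js]; rewrite !mxE jordan_blockX -/a -!val_eqE /=.
    have [sj|sj] := leqP s.-1 j; last by rewrite (ltn_eqF sj) mulr0.
    have -> : j = s.-1 by rewrite -/s in js; lia.
    by rewrite subnn bin0 subn0 eqxx mul1r mulr1.
  have e2J : e2 *m jmx (B i) ^+ k = a ^+ k *: e2 + (k%:R * a ^+ k.-1) *: e1.
    rewrite -rowE; apply/rowP => -[j js]; rewrite !mxE jordan_blockX -/a -!val_eqE /=.
    rewrite -/s in js; have [sj|sj|sj] := ltngtP s.-2 j.
    - have -> : j = s.-1 by lia.
      have -> : (s.-1 - s.-2 = 1)%N by lia.
      by rewrite bin1 eqxx subn1 mulr0 add0r mulr1.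
    - by rewrite [_ == s.-1]ltn_eqF ?mulr0 ?addr0 //; lia.
    - by rewrite -sj subnn bin0 subn0 mul1r mulr1 [_ == s.-1]ltn_eqF ?mulr0 ?addr0 //; lia.
  have e2M : e2 *m bQ (B i) *m (M ^+ k - (a ^+ k)%:M) = ((k%:R * a ^+ k.-1) *: e1) *m bQ (B i).
    rewrite mulmxBr -mulmxA (jdec_QX MB) mulmxA e2J mulmxDl mul_mx_scalar scalemxAl.
    by rewrite addrAC subrr add0r.
  have e1M : e1 *m bQ (B i) *m (M ^+ k - (a ^+ k)%:M) = 0.
    rewrite mulmxBr -mulmxA (jdec_QX MB) mulmxA e1J mul_mx_scalar scalemxAl.
    by rewrite subrr.
  have /(diagonalizable_sqr_ker dM) : e2 *m bQ (B i) *m (M ^+ k - (a ^+ k)%:M) *m (M ^+ k - (a ^+ k)%:M) = 0.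
    by rewrite e2M -!scalemxAl e1M scaler0.
  rewrite e2M => /(jdec_Q_inj MB)/matrixP/(_ 0 (Ordinal s1p))/eqP.
  rewrite !mxE !eqxx mulr1 mulf_eq0 pnatr_eq0 expf_eq0 (negbTE bi) andbF orbF.
  by rewrite (gtn_eqF k0).
have QM i : bQ (B i) *m M ^+ k = beig (B i) ^+ k *: bQ (B i).
  rewrite (jdec_QX MB) -mul_scalar_mx; congr (_ *m _).
  have [bi|bi] := eqVneq (beig (B i)) 0.
    rewrite /jmx bi jordan_block0X ?expr0n ?(gtn_eqF k0) ?raddf0 //.
    by apply: leq_trans nuk; rewrite (jordan_max_size MB) (jdec_nil_le bi).
  apply/matrixP => -[r rs] [c cs]; rewrite jordan_blockX !mxE -val_eqE /=.
  rewrite b1 // !ltnS !leqn0 in rs cs; rewrite (eqP rs) (eqP cs).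
  by rewrite subnn bin0 subn0 mul1r mulr1n.
apply/diagonalizablePeigen; pose rs := undup [seq beig (B i) ^+ k | i <- enum 'I_m].
exists rs; first exact: undup_uniq.
apply/eqmxP; rewrite submx1 /= -(jdec_PQ MB); apply: summx_sub => i _.
apply: submx_trans (submxMl _ _) _.
have rsi : beig (B i) ^+ k \in rs by rewrite mem_undup; apply/mapP; exists i; rewrite ?mem_enum.
rewrite (bigD1_seq _ rsi) ?undup_uniq //=; apply: submx_trans (addsmxSl _ _).
by apply/eigenspaceP.
Qed.

End Diagonalizability.

(** This is all that is kept of the Jordan structure: [ell] witnesses the linear independence of the
    [D c], and the last clause tells whether a factor [k] genuinely occurs. *)
Lemma power_expansion (F : numClosedFieldType) n (M : 'M[F]_n) :
  exists (I : finType) (lam : I -> F) (e : I -> nat) (D : I -> 'M[F]_n)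
         (ell : I -> 'M[F]_n -> F),
  [/\ (forall c, polyfun (ell c)) /\
        (forall y c, ell c (\sum_x y x *: D x) = y c),
      forall k, (max_jordan_size M 0 <= k)%N ->
        M ^+ k = \sum_c (lam c ^+ k * k%:R ^+ e c) *: D c,
      (forall c, nonzero_eigenvalues M (lam c)) /\
        (forall a, nonzero_eigenvalues M a -> exists2 c, lam c = a & e c = 0%N) &
      if `[< diagonalizable (M ^+ maxn 1 (max_jordan_size M 0)) >]
      then forall c, e c = 0%N
      else exists c0 c1, [/\ lam c0 = lam c1, e c0 = 0%N & e c1 = 1%N]].
Proof.
have [m [B MB]] := jordan_dec_exists M.
pose I := {i : {i : 'I_m | beig (B i) != 0} & 'I_(bsize (B (val i)))}.
exists I, (fun x : I => beig (B (val (tag x)))), (fun x : I => tagged x : nat).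
exists (@expcoef _ _ _ B), (expdual MB).
split.
- split; [exact: polyfun_expdual|exact: expdualK].
- by move=> k; exact: expform.
- split=> [c|a [/(jdec_eigenvalue MB)[i ia] a0]].
    by split; [apply/(jdec_eigenvalue MB); exists (val (tag c))|exact: valP (tag c)].
  have i0 : beig (B i) != 0 by rewrite ia.
  have s0 : (0 < bsize (B i))%N by case: MB.
  by exists (existT _ (Sub i i0) (Ordinal s0)).
- case: asboolP => [dM c|ndM].
    move/(diagonalizable_jdec MB): dM => /(_ _ _ (val (tag c)) (valP (tag c))).
    rewrite leq_maxr leq_maxl => /(_ isT isT) h.
    by have := ltn_ord (tagged c); rewrite /= [X in (_ < X)%N]h; case: (tagged c : nat).
  apply: contrapT => hn; apply: ndM; apply/(diagonalizable_jdec MB).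
  + exact: leq_maxr.
  + by rewrite leq_max.
  move=> i bi; apply/eqP; rewrite eqn_leq; apply/andP; split; last by case: MB.
  rewrite leqNgt; apply/negP => s2; apply: hn.
  have s0 : (0 < bsize (B i))%N by case: MB.
  by exists (existT _ (Sub i bi) (Ordinal s0)), (existT _ (Sub i bi) (Ordinal s2)).
Qed.

(** * Finitely generated multiplicative groups *)

Section MonomialProducts.
Context {F : fieldType}.

Definition mprod (I : finType) (x : I -> F) (a : I -> int) : F := \prod_i x i ^ a i.

Lemma mprod_neq0 (I : finType) (x : I -> F) a : (forall i, x i != 0) -> mprod x a != 0.
Proof. by move=> x0; apply/prodf_neq0 => i _; rewrite expfz_neq0. Qed.

Lemma mprod0 (I : finType) (x : I -> F) : mprod x (fun=> 0) = 1.
Proof. by rewrite /mprod big1 // => i _; rewrite expr0z. Qed.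

Lemma mprodD (I : finType) (x : I -> F) a b : (forall i, x i != 0) ->
  mprod x (fun i => a i + b i) = mprod x a * mprod x b.
Proof.
by move=> x0; rewrite -big_split; apply: eq_bigr => i _; rewrite expfzDr.
Qed.

Lemma mprodX (I : finType) (x : I -> F) a k : mprod x a ^ k = mprod x (fun i => a i * k).
Proof.
rewrite /mprod (big_morph (fun y => y ^ k) (id1 := 1) (op1 := *%R)).
- by apply: eq_bigr => i _; rewrite exprz_exp.
- by move=> y z; rewrite expfzMl.
- by rewrite exp1rz.
Qed.

Lemma mprod_comp (I J : finType) (x : I -> F) (A : J -> I -> int) v :
  (forall i, x i != 0) ->
  mprod (fun j => mprod x (A j)) v = mprod x (fun i => \sum_j v j * A j i).
Proof.
move=> x0; rewrite {1}/mprod; under eq_bigr do rewrite mprodX.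
rewrite /mprod exchange_big; apply: eq_bigr => i _.
rewrite (big_morph (fun k => x i ^ k) (id1 := 1) (op1 := *%R)) ?expr0z //.
  by apply: eq_bigr => j _; rewrite mulrC.
by move=> k l; rewrite expfzDr.
Qed.

Lemma mprodZ (I : finType) (x y : I -> F) a :
  mprod (fun i => x i * y i) a = mprod x a * mprod y a.
Proof. by rewrite -big_split; apply: eq_bigr => i _; rewrite expfzMl. Qed.

Lemma mprod_delta (I : finType) (x : I -> F) i : mprod x (fun j => (j == i)%:Z) = x i.
Proof.
rewrite /mprod (bigD1 i) //= eqxx expr1z big1 ?mulr1 // => j /negbTE ->.
by rewrite expr0z.
Qed.

Lemma mul_subgroup_gen (I : finType) (x : I -> F) : (forall i, x i != 0) ->
  mul_subgroup (range (mprod x)).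
Proof.
move=> x0; split.
- by exists (fun=> 0) => //; exact: mprod0.
- by move=> _ [a _ <-]; exact: mprod_neq0.
- by move=> _ _ [a _ <-] [b _ <-]; exists (fun i => a i + b i) => //; exact: mprodD.
- by move=> _ [a _ <-]; exists (fun i => a i * -1) => //; rewrite -mprodX.
Qed.

Lemma mul_subgroupXz (H : set F) x (k : int) : mul_subgroup H -> H x -> H (x ^ k).
Proof.
move=> [H1 H0 HM HV] Hx.
have HX m : H (x ^+ m) by elim: m => [|m IH]; [rewrite expr0|rewrite exprS; exact: HM].
by case: k => m; [exact: HX|exact/HV/HX].
Qed.

Lemma mul_subgroup_mprod (I : finType) (H : set F) (x : I -> F) a :
  mul_subgroup H -> (forall i, H (x i)) -> H (mprod x a).
Proof.
move=> sH Hx; have [H1 _ HM _] := sH.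
by apply: (big_ind H) => // i _; exact: mul_subgroupXz.
Qed.

Lemma smallest_mul_subgroup (I : finType) (x : I -> F) (E : set F) :
  (forall i, x i != 0) -> E `<=` range (mprod x) -> (forall i, E (x i)) ->
  smallest mul_subgroup E = range (mprod x).
Proof.
move=> x0 Ex xE; apply/seteqP; split.
  by apply: smallest_sub => //; exact: mul_subgroup_gen.
move=> _ [a _ <-] H [sH EH]; apply: mul_subgroup_mprod => // i.
exact: EH.
Qed.

Definition mul_indep r (z : 'I_r -> F) :=
  forall a : 'I_r -> int, mprod z a = 1 -> forall i, a i = 0.

Lemma mul_indepP r (z : 'I_r -> F) a b : (forall i, z i != 0) -> mul_indep z ->
  mprod z a = mprod z b -> a =1 b.
Proof.
move=> z0 zi ab i; apply/eqP; rewrite -subr_eq0; apply/eqP.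
apply: (zi (fun i => a i - b i)).
have -> : mprod z (fun i => a i - b i) = mprod z a * mprod z (fun i => b i * -1).
  by rewrite -mprodD //; congr (mprod z); apply/funext => j; rewrite mulrN1.
by rewrite -mprodX ab exprN1 mulfV // mprod_neq0.
Qed.

End MonomialProducts.

(** In characteristic zero ['X^n - 1] is separable, hence has [n] distinct roots, and they form a
    cyclic group. *)
Lemma primitive_root_exists (F : numClosedFieldType) n :
  (0 < n)%N -> exists z : F, n.-primitive_root z.
Proof.
move=> n0; pose p : {poly F} := 'X^n - 1; have [r Dp] := closed_field_poly_normal p.
rewrite (monicP _) ?monicXnsubC // scale1r in Dp.
have rn1 : all n.-unity_root r by apply/allP => z; rewrite -root_prod_XsubC -Dp.
have sr : (n < (size r).+1)%N by rewrite -(size_prod_XsubC r id) -Dp size_XnsubC.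
have [|z _ zn] := hasP (has_prim_root n0 rn1 _ sr); last by exists z.
by rewrite -separable_prod_XsubC -Dp separable_Xn_sub_1 // pnatr_eq0 -lt0n.
Qed.

Lemma prim_root_neq0 (F : fieldType) n (w : F) : n.-primitive_root w -> w != 0.
Proof.
move=> wn; apply/eqP => w0; have := prim_expr_order wn.
by rewrite w0 expr0n (gtn_eqF (prim_order_gt0 wn)) => /eqP; rewrite eq_sym oner_eq0.
Qed.

Lemma prim_root1 (F : fieldType) : 1.-primitive_root (1 : F).
Proof.
have [m wm] := prim_order_exists (ltn0Sn 0) (expr1n F 1).
by rewrite dvdn1 => /eqP <-.
Qed.

Section FinitelyGenerated.
Context {F : numClosedFieldType}.

(* Two roots of unity generate the group of a single one, by Bezout on their
   exponents with respect to a common primitive root. *)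
Lemma join_roots_of_unity N1 N2 (u v : F) :
  (0 < N1)%N -> (0 < N2)%N -> u ^+ N1 = 1 -> v ^+ N2 = 1 ->
  exists t w, t.-primitive_root w /\
    forall y : F, (exists k l : int, y = u ^ k * v ^ l) <-> (exists k : int, y = w ^ k).
Proof.
move=> N10 N20 u1 v1.
have N0 : (0 < N1 * N2)%N by rewrite muln_gt0 N10.
have [xi xiP] := primitive_root_exists F N0.
have xi0 : xi != 0 := prim_root_neq0 xiP.
have [|a ua] := prim_rootP xiP (x := u); first by rewrite exprM u1 expr1n.
have [|b vb] := prim_rootP xiP (x := v); first by rewrite mulnC exprM v1 expr1n.
pose d := gcdz a b; pose w := xi ^ d.
have w1 : w ^+ (N1 * N2) = 1.
  rewrite /w exprnP exprz_exp mulrC -exprz_exp -exprnP (prim_expr_order xiP).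
  by rewrite exp1rz.
have [t wt _] := prim_order_exists N0 w1.
exists t, w; split=> // y; split=> [[k [l ->]]|[k ->]].
  have [k' ak] : exists k', (a : int) = k' * d by apply/dvdzP; exact: dvdz_gcdl.
  have [l' bl] : exists l', (b : int) = l' * d by apply/dvdzP; exact: dvdz_gcdr.
  exists (k' * k + l' * l); rewrite ua vb !exprnP !exprz_exp ak bl -expfzDr //.
  by congr (xi ^ _); ring.
have [p [q pq]] := Bezoutz a b; exists (p * k), (q * k).
rewrite ua vb !exprnP !exprz_exp -expfzDr //.
by congr (xi ^ _); rewrite /d -pq; ring.
Qed.

Lemma mprod_unimodular s (x : 'I_s -> F) (R : 'M[int]_s) :
  (forall i, x i != 0) -> R \in unitmx ->
  range (mprod x) = range (mprod (fun j => mprod x (R j))).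
Proof.
move=> x0 Ru; apply/seteqP; split=> _ [a _ <-].
  exists (fun j => ((\row_i a i) *m invmx R) 0 j) => //; rewrite mprod_comp //.
  congr (mprod x); apply/funext => i; transitivity (((\row_i a i) *m invmx R *m R) 0 i).
    by rewrite [RHS]mxE.
  by rewrite mulmxKV // mxE.
by exists (fun i => \sum_j a j * R j i) => //; rewrite mprod_comp.
Qed.

(* The Smith normal form of a relation gives a unimodular change of generators
   after which the relation reads y_0 ^ g = 1. *)
Lemma mprod_relation s (x : 'I_s.+1 -> F) : (forall i, x i != 0) -> ~ mul_indep x ->
  exists (y : 'I_s.+1 -> F) N, [/\ (0 < N)%N, y ord0 ^+ N = 1, forall i, y i != 0 &
    range (mprod x) = range (mprod y)].
Proof.
move=> x0 /existsNP[b /not_implyP[xb /existsNP[i bi]]].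
have [L _ [R Ru [d _ bE]]] := int_Smith_normal_form (\row_i b i).
(* The relation is a single row, so only the first diagonal entry matters and every exponent is [g]
   times an entry of the first row of [R]. *)
pose g := L 0 0 * d`_0.
have bg j : b j = g * R ord0 j.
  have /matrixP/(_ 0 j) := bE; rewrite !mxE => ->; rewrite (bigD1 ord0) //= big1 ?addr0.
    by rewrite mxE big_ord1 mxE eqxx.
  by move=> l; rewrite -val_eqE /= eq_sym => /negbTE l0; rewrite mxE big_ord1 mxE l0 mulr0n mulr0 mul0r.
have g0 : g != 0 by apply/eqP => g0; apply: bi; rewrite bg g0 mul0r.
pose y j := mprod x (R j).
have yg : y ord0 ^ g = 1.
  by rewrite /y mprodX -[RHS]xb; congr (mprod x); apply/funext => j; rewrite bg mulrC.
exists y, `|g|%N; split.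
- by rewrite absz_gt0.
- rewrite exprnP; have [gp|gn] := leP 0 g; first by rewrite gez0_abs.
  by rewrite ltz0_abs // -mulrN1 -exprz_exp yg exp1rz.
- by move=> j; exact: mprod_neq0.
- exact: mprod_unimodular.
Qed.

(** Induction on the number of generators. If they are dependent, [mprod_relation] makes one of them
    a root of unity, which [join_roots_of_unity] merges with the torsion part of the others. *)
Lemma mprod_structure s (x : 'I_s -> F) : (forall i, x i != 0) ->
  exists t (w : F) r (z : 'I_r -> F), [/\ t.-primitive_root w, forall i, z i != 0,
    mul_indep z & forall y, range (mprod x) y <-> exists k b, y = w ^ k * mprod z b].
Proof.
elim: s x => [|s IH] x x0.
  exists 1%N, 1, 0%N, x; split=> //; [exact: prim_root1|by move=> ? ? []|].
  move=> y; split=> [[a _ <-]|[k [b ->]]]; first by exists 0, a; rewrite mul1r.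
  by exists b; rewrite ?exp1rz ?mul1r.
have [xi|/(mprod_relation x0)[y [N [N0 yN y0 xy]]]] := pselect (mul_indep x).
  exists 1%N, 1, s.+1, x; split=> //; first exact: prim_root1.
  move=> y; split=> [[a _ <-]|[k [b ->]]]; first by exists 0, a; rewrite mul1r.
  by exists b; rewrite ?exp1rz ?mul1r.
have [t [w [r [z [wt z0 zi yz]]]]] := IH (fun i => y (lift ord0 i)) (fun i => y0 _).
have [t' [w' [wt' ww']]] := join_roots_of_unity N0 (prim_order_gt0 wt) yN (prim_expr_order wt).
exists t', w', r, z; split=> // u; rewrite xy.
have split_y a : mprod y a = y ord0 ^ a ord0 * mprod (fun i => y (lift ord0 i)) (fun i => a (lift ord0 i)).
  by rewrite /mprod big_ord_recl.
split=> [[a _ <-]|[k [b ->]]].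
  have [|k [b yb]] := (yz (mprod (fun i => y (lift ord0 i)) (fun i => a (lift ord0 i)))).1.
    by exists (fun i => a (lift ord0 i)).
  have [|k' kk'] := (ww' (y ord0 ^ a ord0 * w ^ k)).1; first by exists (a ord0), k.
  by exists k', b; rewrite split_y yb mulrA kk'.
have [|k1 [k2 kE]] := (ww' (w' ^ k)).2; first by exists k.
have [|a _ aE] := (yz (w ^ k2 * mprod z b)).2; first by exists k2, b.
exists (fun i => oapp a k1 (unlift ord0 i)) => //; rewrite split_y unlift_none /= kE -mulrA -aE.
by congr (_ * mprod _ _); apply/funext => i; rewrite liftK.
Qed.

End FinitelyGenerated.

(** * Torsion and rank of a group split into roots of unity and a free part *)

Section GroupRank.
Context {F : fieldType} (t r : nat) (w : F) (z : 'I_r -> F).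
Hypotheses (wt : t.-primitive_root w) (z0 : forall i, z i != 0) (zi : mul_indep z).

Let t0 := prim_order_gt0 wt.
Let w0 := prim_root_neq0 wt.

Lemma prim_root_exprzM (k : int) : w ^ (k * t) = 1.
Proof. by rewrite mulrC -exprz_exp -exprnP (prim_expr_order wt) exp1rz. Qed.

Lemma prim_root_exprz_mod (k : int) : w ^ k = w ^+ `|(k %% t)%Z|%N.
Proof.
rewrite {1}(divz_eq k t) expfzDr // prim_root_exprzM mul1r exprnP gez0_abs // modz_ge0 //.
by rewrite eqz_nat -lt0n.
Qed.

Variable G : set F.
Hypothesis GE : forall y, G y <-> exists k b, y = w ^ k * mprod z b.

(** Raising to the power [m * t] kills the factor [w ^ k], and independence of [z] then forces the
    free exponents to vanish. *)
Lemma torsion_root_of_unity y : torsion G y <-> exists k : int, y = w ^ k.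
Proof.
split=> [[/GE[k [b yE]] [m m0 ym]]|[k ->]]; last first.
  split; first by apply/GE; exists k, (fun=> 0); rewrite mprod0 mulr1.
  by exists t => //; rewrite exprnP exprz_exp prim_root_exprzM.
have : mprod z (fun i => b i * (m * t)%N) = 1.
  have : y ^ (m * t)%N = 1 by rewrite -exprnP exprM ym expr1n.
  by rewrite yE expfzMl exprz_exp PoszM mulrA prim_root_exprzM mul1r mprodX.
move=> /zi b0; exists k; rewrite yE (_ : b = fun=> 0) ?mprod0 ?mulr1 //.
apply/funext => i; have /eqP := b0 i; rewrite mulf_eq0 eqz_nat muln_eq0 => /orP[/eqP//|].
by rewrite !gtn_eqF.
Qed.

Lemma torsion_card : torsion G #= `I_t.
Proof.
have -> : torsion G = (fun i => w ^+ i) @` `I_t.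
  apply/seteqP; split=> [y /torsion_root_of_unity[k ->]|_ [i _ <-]].
    exists `|(k %% t)%Z|%N; last by rewrite -prim_root_exprz_mod.
    by rewrite /= -ltz_nat gez0_abs ?ltz_pmod ?modz_ge0 ?eqz_nat -?lt0n.
  by apply/torsion_root_of_unity; exists i.
apply: inj_card_eq => i j; rewrite !inE /= => it jt /eqP.
by rewrite (eq_prim_root_expr wt) !modn_small // => /eqP.
Qed.

Lemma group_rank_free : group_rank G r.
Proof.
exists (range (mprod z)); split.
- exact: mul_subgroup_gen.
- by move=> _ [b _ <-]; apply/GE; exists 0, b; rewrite mul1r.
- apply/seteqP; split=> [y [[b _ <-] [_ [m m0]]]|_ ->]; last first.
    split; first by exists (fun=> 0) => //; exact: mprod0.
    by apply/torsion_root_of_unity; exists 0.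
  rewrite exprnP mprodX => /zi b0; rewrite /= (_ : b = fun=> 0) ?mprod0 //.
  apply/funext => i; have /eqP := b0 i; rewrite mulf_eq0 => /orP[/eqP//|].
  by rewrite eqz_nat gtn_eqF.
- apply/seteqP; split=> [y /GE[k [b ->]]|_ [_ /torsion_root_of_unity[k ->] [_ [b _ <-] <-]]].
    exists (w ^ k); first by apply/torsion_root_of_unity; exists k.
    by exists (mprod z b); first by exists b.
  by apply/GE; exists k, b.
- by exists z; split.
Qed.

End GroupRank.

(** * Density of exponential sequences in tori *)

Section ExponentialPolynomials.
Context {F : numFieldType}.

Lemma poly_nat_roots_eq0 (p : {poly F}) K :
  (forall k, (K <= k)%N -> p.[k%:R] = 0) -> p = 0.
Proof.
move=> pk; apply: (@roots_geq_poly_eq0 _ _ [seq (K + i)%:R | i <- iota 0 (size p)]).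
- by apply/allP => _ /mapP[i _ ->]; apply/rootP; rewrite pk ?leq_addr.
- by rewrite map_inj_uniq ?iota_uniq // => i j /eqP; rewrite eqr_nat eqn_add2l => /eqP.
- by rewrite size_map size_iota.
Qed.

Let shift (p : {poly F}) := p \Po ('X + 1%:P).

Let size_shift p : size (shift p) = size p.
Proof. by rewrite size_comp_poly2 // size_XaddC. Qed.

Let coef_shift p : (shift p)`_(size p).-1 = lead_coef p.
Proof.
by rewrite -{1}size_shift -lead_coefE lead_coef_comp ?size_XaddC // lead_coefXaddC expr1n mulr1.
Qed.

(* The operator f(k) |-> f(k+1) - w0 f(k) lowers the degree of the coefficient of
   w0 ^ k and keeps the leading terms of the others up to a nonzero factor. *)
Lemma exponential_polynomial_eq0 (ws : seq F) (p : F -> {poly F}) K :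
  uniq ws -> 0 \notin ws ->
  (forall k, (K <= k)%N -> \sum_(w <- ws) (p w).[k%:R] * w ^+ k = 0) ->
  {in ws, forall w, p w = 0}.
Proof.
elim: ws p => // w0 ws IHw p /= /andP[w0ws uws]; rewrite inE negb_or eq_sym => /andP[w00 ws0].
(* Inside the induction on the list of bases runs one on the size of the coefficient of the first
   base. *)
have [s] := ubnP (size (p w0)); elim: s p => // s IHs p; rewrite ltnS => ps h.
have [p0|p0] := eqVneq (p w0) 0.
  move=> w; rewrite inE => /predU1P[->//|]; apply: IHw => // k /h.
  by rewrite big_cons p0 horner0 mul0r add0r.
pose p' w := w *: shift (p w) - w0 *: p w.
have p'0 : {in w0 :: ws, forall w, p' w = 0}.
  apply: IHs.
    rewrite (leq_trans _ ps) // /p' -scalerBr size_scale //.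
    have sp : (0 < size (p w0))%N by rewrite size_poly_gt0.
    rewrite -(prednK sp) ltnS; apply/leq_sizeP => j; rewrite leq_eqVlt => /predU1P[<-|jp].
      by rewrite coefB coef_shift lead_coefE subrr.
    by rewrite prednK // in jp; rewrite coefB !nth_default ?subrr // size_shift.
  move=> k Kk; transitivity (\sum_(w <- w0 :: ws) (p w).[k.+1%:R] * w ^+ k.+1 -
      w0 * \sum_(w <- w0 :: ws) (p w).[k%:R] * w ^+ k); last first.
    by rewrite !h ?mulr0 ?subr0 // leqW.
  rewrite mulr_sumr -sumrB; apply: eq_bigr => w _.
  rewrite hornerD hornerN !hornerZ horner_comp !hornerE exprS -natr1.
  by rewrite mulrBl [_ * (w * _)]mulrCA mulrA.
have pw w : w \in ws -> p w = 0.
  move=> wws; have /polyP/(_ (size (p w)).-1)/eqP : p' w = 0 by rewrite p'0 // inE wws orbT.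
  rewrite coefB !coefZ coef_shift -lead_coefE -mulrBl coef0 mulf_eq0 subr_eq0.
  by case/orP => [/eqP ww|]; [rewrite -ww wws in w0ws|rewrite lead_coef_eq0 => /eqP].
suff p00 : p w0 = 0 by rewrite p00 eqxx in p0.
apply: (@poly_nat_roots_eq0 _ K) => k /h; rewrite big_cons big_seq big1 ?addr0.
  by move/eqP; rewrite mulf_eq0 expf_eq0 (negbTE w00) andbF orbF => /eqP.
by move=> w /pw ->; rewrite horner0 mul0r.
Qed.

End ExponentialPolynomials.

Section TorusParameters.

(** All extra coordinates receive [g]; in the applications [u] is a boolean read as 0 or 1, so there
    is at most one. *)
Definition comb T r u (f : 'I_r -> T) (g : T) (j : 'I_(r + u)) : T :=
  match fintype.split j with inl j' => f j' | inr _ => g end.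

Lemma comb_lshift T r u (f : 'I_r -> T) g (j : 'I_r) : comb f g (lshift u j) = f j.
Proof. by rewrite /comb (unsplitK (inl j)). Qed.

Lemma comb_rshift T r u (f : 'I_r -> T) g (j : 'I_u) : comb f g (rshift r j) = g.
Proof. by rewrite /comb (unsplitK (inr j)). Qed.

Lemma combK (r : nat) (u : bool) (a : 'I_(r + u) -> nat) j :
  a j = comb (fun j => a (lshift u j)) (\sum_(l < u) a (rshift r l))%N j.
Proof.
case: (split_ordP j) => l ->; first by rewrite comb_lshift.
by rewrite comb_rshift; case: u a j l => a j l; [rewrite big_ord1 ord1|case: l].
Qed.

Lemma comb_sum_bool (r : nat) (u : bool) (a : 'I_(r + u) -> nat) :
  (\sum_(l < u) a (rshift r l) == 0)%N || u.
Proof. by case: u a => a; rewrite ?orbT // big_ord0. Qed.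

Context {F : numFieldType} (r : nat) (u : bool) (z : 'I_r -> F).
Hypotheses (z0 : forall j, z j != 0) (zi : mul_indep z).

(* The last coordinate, present iff u holds, carries the unipotent part of M^k. *)
Definition torus_point k : 'I_(r + u) -> F := comb (fun j => z j ^+ k) k%:R.

Lemma mprod_torus_point (b : 'I_r -> int) (e : nat) k : (e == 0)%N || u ->
  mprod (torus_point k) (comb b e%:Z) = mprod z b ^+ k * k%:R ^+ e.
Proof.
move=> eu; rewrite /mprod big_split_ord /=.
under eq_bigr do rewrite /torus_point !comb_lshift exprnP exprz_exp mulrC -exprz_exp.
under [X in _ * X]eq_bigr do rewrite /torus_point !comb_rshift.
rewrite -/(mprod z b) [mprod z b ^+ k]exprnP mprodX; congr (_ * _).
  by apply: eq_bigr => j _; rewrite exprz_exp.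
by case: u eu => [_|/orP[/eqP->|//]]; rewrite ?big_ord1 ?big_ord0.
Qed.

Lemma torus_point_neq0 k j : (0 < k)%N -> torus_point k j != 0.
Proof.
move=> k0; rewrite /torus_point /comb; case: fintype.splitP => j' _.
  by rewrite expf_neq0.
by rewrite pnatr_eq0 -lt0n.
Qed.

(** At [k = i0 + t * l] the value of [f] is an exponential polynomial in [l]. Distinct monomials of
    [f] differ in their base or in their power of [k], so every coefficient vanishes. *)
Lemma torus_point_dense (f : {mpoly F[r + u]}) t i0 K : (0 < t)%N ->
  (forall l, (K <= l)%N -> f.@[torus_point (i0 + t * l)] = 0) -> f = 0.
Proof.
move=> t0 h.
pose W (m : 'X_{1..(r + u)}) := mprod z (fun j => (m (lshift u j) : int)).
pose e (m : 'X_{1..(r + u)}) := (\sum_(l < u) m (rshift r l))%N.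
have W0 m : W m != 0 by exact: mprod_neq0.
have fE k : f.@[torus_point k] = \sum_(m <- msupp f) f@_m * (W m ^+ k * k%:R ^+ e m).
  rewrite mevalE; apply: eq_bigr => m _; congr (_ * _).
  rewrite -mprod_torus_point; last first.
    exact: comb_sum_bool.
  apply: eq_bigr => j _; rewrite exprnP; congr (_ ^ _); rewrite (combK m j) /comb.
  by case: fintype.split.
(* Taking [t]-th powers does not identify different bases, as [z] is multiplicatively
   independent. *)
have We_inj m m' : W m ^+ t = W m' ^+ t -> e m = e m' -> m = m'.
  rewrite !exprnP !mprodX => /(mul_indepP z0 zi) Wm em; apply/mnmP => j.
  rewrite (combK m j) (combK m' j) -/(e m) em /comb; case: fintype.split => // l.
  by have /eqP := Wm l; rewrite -!PoszM eqz_nat eqn_pmul2r // => /eqP.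
pose ws := undup [seq W m ^+ t | m <- msupp f].
(* [P w] collects the terms of base [w] as a polynomial in the exponent [k], and [q] substitutes
   [k = i0 + t * l]. *)
pose P w := \sum_(m <- msupp f | W m ^+ t == w) (f@_m * W m ^+ i0) *: 'X^(e m) : {poly F}.
pose q : {poly F} := (t%:R)%:P * 'X + (i0%:R)%:P.
have tR : t%:R != 0 :> F by rewrite pnatr_eq0 -lt0n.
have sq : size q = 2%N by rewrite size_MXaddC polyC_eq0 (negbTE tR) /= size_polyC tR.
have Pq : {in ws, forall w, P w \Po q = 0}.
  apply: (@exponential_polynomial_eq0 _ _ _ K); first exact: undup_uniq.
    by rewrite mem_undup; apply/mapP => -[m _ /eqP]; rewrite eq_sym expf_eq0 (negbTE (W0 m)) andbF.
  move=> l Kl; rewrite -[RHS](h l Kl) fE.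
  under eq_bigr do rewrite horner_comp horner_sum mulr_suml.
  rewrite (exchange_big_dep xpredT) //= big_seq [RHS]big_seq; apply: eq_bigr => m mf.
  under eq_bigl do rewrite eq_sym.
  rewrite -big_filter filter_pred1_uniq ?undup_uniq ?mem_undup ?(map_f (fun m => W m ^+ t)) // big_seq1.
  rewrite !hornerE natrD natrM exprD exprM [t%:R * _ + _]addrC.
  by rewrite mulrAC -[f@_m * _ * _]mulrA.
apply/mpolyP => m; rewrite mcoeff0; apply: contrapT => /eqP; rewrite -mcoeff_msupp => mf.
have /Pq/eqP : W m ^+ t \in ws by rewrite mem_undup (map_f (fun m => W m ^+ t)).
rewrite comp_poly_eq0 ?sq // => /eqP/polyP/(_ (e m))/eqP.
rewrite coef_sum coef0 big_mkcond (bigD1_seq m) ?msupp_uniq //= eqxx coefZ coefXn eqxx mulr1 big1 ?addr0.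
  by rewrite mulf_eq0 expf_eq0 (negbTE (W0 m)) andbF orbF mcoeff_eq0 mf.
move=> m' mm'; case: (W m' ^+ t =P _) => // wm; rewrite coefZ coefXn; case: eqP => [em|]; rewrite ?mulr0 //.
by rewrite (We_inj _ _ wm) ?eqxx // in mm'.
Qed.

End TorusParameters.

(** * Laurent functions *)

Section LaurentFunctions.
Context {F : fieldType} (d : nat).
Implicit Types (phi psi : ('I_d -> F) -> F) (x : 'I_d -> F).

Let h : {mpoly F[d]} := \prod_j 'X_j.

Let hE x : h.@[x] = \prod_j x j.
Proof. by rewrite /h rmorph_prod; apply: eq_bigr => j _ /=; rewrite mevalXU. Qed.

Let h_neq0 x : (forall j, x j != 0) -> h.@[x] != 0.
Proof. by move=> x0; rewrite hE; apply/prodf_neq0 => j _; exact: x0. Qed.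

(** Laurent polynomials as functions on the torus, over a power of the product of all coordinates as
    common denominator; values off the torus are unconstrained. *)
Definition laurent phi := exists (f : {mpoly F[d]}) N,
  forall x, (forall j, x j != 0) -> phi x * (\prod_j x j) ^+ N = f.@[x].

Lemma laurent_const c : laurent (fun=> c).
Proof. by exists c%:MP, 0%N => x _; rewrite mevalC mulr1. Qed.

Lemma laurentD phi psi : laurent phi -> laurent psi -> laurent (fun x => phi x + psi x).
Proof.
move=> [f [N fE]] [g [K gE]]; exists (f * h ^+ K + g * h ^+ N), (N + K)%N => x x0.
by rewrite mevalD !mevalM !rmorphXn /= hE -fE // -gE // exprD; ring.
Qed.

Lemma laurentM phi psi : laurent phi -> laurent psi -> laurent (fun x => phi x * psi x).
Proof.
move=> [f [N fE]] [g [K gE]]; exists (f * g), (N + K)%N => x x0.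
by rewrite mevalM -fE // -gE // exprD; ring.
Qed.

Lemma laurent_sum (I : Type) (r : seq I) (phi : I -> ('I_d -> F) -> F) :
  (forall i, laurent (phi i)) -> laurent (fun x => \sum_(i <- r) phi i x).
Proof.
move=> hphi; elim: r => [|i r IH].
  by under eq_fun do rewrite big_nil; exact: laurent_const.
by under eq_fun do rewrite big_cons; exact: laurentD.
Qed.

Lemma laurent_prod (I : Type) (r : seq I) (phi : I -> ('I_d -> F) -> F) :
  (forall i, laurent (phi i)) -> laurent (fun x => \prod_(i <- r) phi i x).
Proof.
move=> hphi; elim: r => [|i r IH].
  by under eq_fun do rewrite big_nil; exact: laurent_const.
by under eq_fun do rewrite big_cons; exact: laurentM.
Qed.

Lemma laurentX phi n : laurent phi -> laurent (fun x => phi x ^+ n).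
Proof.
move=> hphi; elim: n => [|n IH]; first exact: laurent_const.
by under eq_fun do rewrite exprS; exact: laurentM.
Qed.

Lemma laurent_meval k (f : {mpoly F[k]}) (v : 'I_k -> ('I_d -> F) -> F) :
  (forall i, laurent (v i)) -> laurent (fun x => f.@[v ^~ x]).
Proof.
move=> hv; under eq_fun do rewrite mevalE.
apply: laurent_sum => m; apply: laurentM; first exact: laurent_const.
by apply: laurent_prod => i; exact: laurentX.
Qed.

Lemma laurent_mprod (a : 'I_d -> int) : laurent (fun x => mprod x a).
Proof.
(* [N] bounds the absolute values of all exponents, so the [N]-th power of the product of the
   coordinates clears every denominator. *)
pose N := (\sum_j `|a j|)%N.
exists (\prod_j 'X_j ^+ `|(a j + N)%R|), N => x x0.
rewrite rmorph_prod -prodrXl -big_split; apply: eq_bigr => j _ /=.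
rewrite rmorphXn /= mevalXU !exprnP -expfzDr // gez0_abs //.
have : (`|a j| <= N)%N by rewrite /N (bigD1 j) //= leq_addr.
by lia.
Qed.

Lemma laurent_polyfun p q (Phi : ('I_d -> F) -> 'M[F]_(p, q)) chi :
  (forall i j, laurent (fun x => Phi x i j)) -> polyfun chi ->
  laurent (fun x => chi (Phi x)).
Proof.
move=> hPhi [f ->]; rewrite /eval_mx.
apply: (@laurent_meval _ f (fun i x => mxvec (Phi x) 0 i)) => k.
by case/mxvec_indexP: k => i j; under eq_fun do rewrite mxvecE.
Qed.

(** After clearing denominators this is the absence of zero divisors among polynomials; the density
    hypothesis passes from functions to polynomials. *)
Lemma laurent_eq0 phi psi : (forall f : {mpoly F[d]},
    (forall x, (forall j, x j != 0) -> f.@[x] = 0) -> f = 0) ->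
  laurent phi -> laurent psi ->
  (forall x, (forall j, x j != 0) -> phi x * psi x = 0) ->
  (forall x, (forall j, x j != 0) -> phi x = 0) \/
  (forall x, (forall j, x j != 0) -> psi x = 0).
Proof.
move=> dense [f [N fE]] [g [K gE]] phipsi.
have /eqP : f * g = 0.
  by apply: dense => x x0; rewrite mevalM -fE // -gE // mulrACA phipsi // mul0r.
rewrite mulf_eq0 => /orP[/eqP f0|/eqP g0]; [left|right] => x x0.
  have /eqP := fE x x0; rewrite f0 meval0 -hE mulf_eq0 expf_eq0.
  by rewrite (negbTE (h_neq0 x0)) andbF orbF => /eqP.
have /eqP := gE x x0; rewrite g0 meval0 -hE mulf_eq0 expf_eq0.
by rewrite (negbTE (h_neq0 x0)) andbF orbF => /eqP.
Qed.

Definition mdeg_le B (f : {mpoly F[d]}) := forall m, m \in msupp f -> (mdeg m <= B)%N.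

Lemma mdeg_le_msize f : mdeg_le (msize f) f.
Proof. by move=> m /msize_mdeg_lt /ltnW. Qed.

Lemma mdeg_le1 : mdeg_le 0 1.
Proof. by move=> m; rewrite msupp1 inE => /eqP ->; rewrite mdeg0. Qed.

Lemma mdeg_leM B C f g : mdeg_le B f -> mdeg_le C g -> mdeg_le (B + C) (f * g).
Proof.
move=> fB gC m /msuppM_le/allpairsP[[m1 m2] /= [/fB m1B /gC m2C ->]].
by rewrite mdegD leq_add.
Qed.

Lemma mdeg_leX B f n : mdeg_le B f -> mdeg_le (B * n) (f ^+ n).
Proof.
move=> fB; elim: n => [|n IH]; first by rewrite muln0; exact: mdeg_le1.
by rewrite mulnS exprS; exact: mdeg_leM.
Qed.

Lemma mdeg_leW B C f : (B <= C)%N -> mdeg_le B f -> mdeg_le C f.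
Proof. by move=> BC fB m /fB mB; exact: leq_trans mB BC. Qed.

(* Fewer monomials than polynomials. *)
Lemma mpoly_dependent (I : finType) (f : I -> {mpoly F[d]}) B :
  (forall i, mdeg_le B (f i)) -> (B.+1 ^ d < #|I|)%N ->
  exists2 c : I -> F, (exists i, c i != 0) & \sum_i c i *: f i = 0.
Proof.
(* [J] indexes the monomials with all exponents at most [B], which include those of degree at most
   [B]. *)
move=> fB dI; pose J : finType := {ffun 'I_d -> 'I_B.+1}.
pose A : 'M[F]_(#|I|, #|J|) :=
  \matrix_(i, j) (f (enum_val i))@_[multinom ((enum_val j : {ffun 'I_d -> 'I_B.+1}) k : nat) | k < d].
have : kermx A != 0.
  rewrite -mxrank_eq0 mxrank_ker -lt0n subn_gt0 (leq_ltn_trans (rank_leq_col A)) //.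
  by rewrite card_ffun !card_ord.
case/rowV0Pn => v /sub_kermxP vA v0.
exists (fun i => v 0 (enum_rank i)).
  apply: contrapT => /forallNP c0; move/eqP: v0; apply; apply/rowP => k; rewrite mxE.
  by have := c0 (enum_val k); rewrite enum_valK => /negP; rewrite negbK => /eqP.
apply/mpolyP => m; rewrite mcoeff0 (raddf_sum (mcoeff m)) /=.
under eq_bigr do rewrite mcoeffZ.
have [mB|mB] := boolP [forall k, (m k < B.+1)%N]; last first.
  rewrite big1 // => i _; rewrite memN_msupp_eq0 ?mulr0 //.
  apply: contra mB => /fB mB; apply/forallP => k; rewrite ltnS (leq_trans _ mB) //.
  by rewrite mdegE (bigD1 k) //= leq_addr.
pose j : J := [ffun k => Ordinal (forallP mB k)].
have /rowP/(_ (enum_rank j)) := vA; rewrite !mxE => vAj; rewrite -[RHS]vAj.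
rewrite [RHS](reindex_onto enum_rank enum_val) /=; last by move=> k _; rewrite enum_valK.
apply: eq_big => [i|i _]; first by rewrite enum_rankK eqxx.
rewrite mxE !enum_rankK; congr (_ * mcoeff _ _).
by apply/mnmP => k; rewrite mnmE ffunE.
Qed.

End LaurentFunctions.

(** * Images of tori under Laurent maps: dimension and irreducibility *)

Section LaurentImage.
Context {F : fieldType} (d p q : nat) (Phi : ('I_d -> F) -> 'M[F]_(p, q)).
Hypothesis Phi_laurent : forall i j, laurent (fun x => Phi x i j).

Let T := [set x : 'I_d -> F | forall j, x j != 0].

(** The numerator of the monomial [a] in the fractions [f i / h i], over the common denominator
    formed by the [N]-th powers of all [h i]. *)
Fixpoint box_mpoly N e (f h : nat -> {mpoly F[d]}) : box N e -> {mpoly F[d]} :=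
  match e with
  | 0 => fun=> 1
  | e'.+1 => fun a => f e' ^+ a.1 * h e' ^+ (N - a.1) * box_mpoly f h a.2
  end.

Lemma meval_box_mpoly N e (f h : nat -> {mpoly F[d]}) (g : nat -> F) x (a : box N e) :
  (forall i, g i * (h i).@[x] = (f i).@[x]) ->
  (box_mpoly f h a).@[x] = monom g a * \prod_(i < e) (h i).@[x] ^+ N.
Proof.
move=> ghf; elim: e a => [|e IH] a /=; first by rewrite meval1 big_ord0 mulr1.
rewrite !mevalM !rmorphXn /= IH big_ord_recr /= -ghf exprMn.
have -> : (h e).@[x] ^+ N = (h e).@[x] ^+ a.1 * (h e).@[x] ^+ (N - a.1).
  by rewrite -exprD subnKC // ltnW.
by ring.
Qed.

Lemma mdeg_le_box_mpoly N e (f h : nat -> {mpoly F[d]}) (a : box N e) :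
  mdeg_le ((\sum_(i < e) (msize (f i) + msize (h i))) * N) (box_mpoly f h a).
Proof.
elim: e a => [|e IH] a /=; first by rewrite big_ord0; exact: mdeg_le1.
rewrite big_ord_recr /= mulnDl addnC; apply: mdeg_leM (IH _).
have aN : (a.1 <= N)%N by exact/ltnW/ltn_ord.
rewrite mulnDl; apply: mdeg_leM.
  apply: (@mdeg_leW _ _ (msize (f e) * a.1)); first by rewrite leq_mul2l aN orbT.
  by apply: mdeg_leX; exact: mdeg_le_msize.
apply: (@mdeg_leW _ _ (msize (h e) * (N - a.1))); first by rewrite leq_mul2l leq_subr orbT.
by apply: mdeg_leX; exact: mdeg_le_msize.
Qed.

(* For N > (delta + 1)^d, the N^e products of the e functions are combinations of
   at most (delta N + 1)^d < N^(d + 1) monomials. *)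
Lemma algindep_le e (g : nat -> 'M[F]_(p, q) -> F) :
  (forall i, polyfun (g i)) -> algindep (zariski_closure (Phi @` T)) e g -> (e <= d)%N.
Proof.
move=> pg gi; rewrite leqNgt; apply/negP => de.
have [fN fNE] := choice (fun i => laurent_polyfun Phi_laurent (pg i)).
have [K KE] := choice fNE.
pose h i : {mpoly F[d]} := (\prod_j 'X_j) ^+ K i.
have hE i x : (h i).@[x] = (\prod_j x j) ^+ K i.
  rewrite rmorphXn rmorph_prod /=; congr (_ ^+ _).
  by apply: eq_bigr => j _; rewrite mevalXU.
pose delta := (\sum_(i < e) (msize (fN i) + msize (h i)))%N.
pose N := ((delta.+1) ^ d).+1.
have [||c [a0 ca0] cE] := @mpoly_dependent _ d (box N e) (box_mpoly fN h) (delta * N).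
- exact: mdeg_le_box_mpoly.
- rewrite card_box (@leq_trans (N ^ d.+1)) ?leq_pexp2l //.
  rewrite (@leq_ltn_trans ((delta.+1 * N) ^ d)) //.
    have expW k l m : (k <= l)%N -> (k ^ m <= l ^ m)%N.
      by case: m => // m kl; rewrite leq_exp2r.
    by apply: expW; rewrite mulSn; lia.
  by rewrite expnMn expnS ltn_mul2r expn_gt0 /= ltnS.
suff : c a0 = 0 by move/eqP; rewrite (negbTE ca0).
apply: (gi N c) => A /zariski_closureP/(_ (fun A => \sum_a c a * monom (g ^~ A) a)); apply.
  apply: polyfun_sum => a; apply: polyfunM; first exact: polyfun_const.
  exact: polyfun_monom.
move=> _ [x x0 <-].
have x0' : \prod_(i < e) (h i).@[x] ^+ N != 0.
  apply/prodf_neq0 => i _; rewrite hE !expf_neq0 //.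
  by apply/prodf_neq0 => j _; exact: x0.
apply: (mulIf x0'); rewrite mul0r -[RHS](meval0 x) -[in RHS]cE rmorph_sum mulr_suml /=.
apply: eq_bigr => a _; rewrite mevalZ -mulrA; congr (_ * _).
by rewrite (@meval_box_mpoly _ _ _ _ (fun i => g i (Phi x))) // => i; rewrite hE KE.
Qed.

Lemma irreducible_chain_le e c :
  irreducible_chain (zariski_closure (Phi @` T)) e c -> (e <= d)%N.
Proof.
move=> ch; have [g pg gi] := irreducible_chain_algindep ch.
apply: (algindep_le pg); apply: algindepS gi.
by case: ch => + _ => /(_ e (leqnn _))[].
Qed.

Lemma irreducible_laurent_image :
  (forall f : {mpoly F[d]}, (forall x, T x -> f.@[x] = 0) -> f = 0) ->
  irreducible_closed (zariski_closure (Phi @` T)).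
Proof.
move=> dense; apply: irreducible_closure.
  by exists (Phi (fun=> 1)); exists (fun=> 1) => //= j; exact: oner_neq0.
move=> phi psi pphi ppsi h.
have [|h'|h'] := laurent_eq0 dense (laurent_polyfun Phi_laurent pphi) (laurent_polyfun Phi_laurent ppsi).
- by move=> x x0; apply: h; exists x.
- by left=> _ [x x0 <-]; exact: h'.
- by right=> _ [x x0 <-]; exact: h'.
Qed.

End LaurentImage.

(** * The irreducible components of the closure *)

Section Components.
Context {F : numFieldType} (n : nat) (I : finType).
Variables (e : I -> nat) (D : I -> 'M[F]_n) (ell : I -> 'M[F]_n -> F).
Hypotheses (ell_poly : forall c, polyfun (ell c))
  (ellK : forall y c, ell c (\sum_x y x *: D x) = y c).
Variables (t : nat) (w : F) (r : nat) (z : 'I_r -> F) (u : bool).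
Hypotheses (wt : t.-primitive_root w) (z0 : forall j, z j != 0) (zi : mul_indep z).
Variables (s : I -> int) (al : I -> 'I_r -> int).
Hypothesis eu : forall c, (e c == 0)%N || u.

Let lam c := w ^ s c * mprod z (al c).
Let T := [set x : 'I_(r + u) -> F | forall j, x j != 0].
Let w0 : w != 0 := prim_root_neq0 wt.
Let t0 : (0 < t)%N := prim_order_gt0 wt.
Let lam0 c : lam c != 0. Proof. by rewrite mulf_neq0 ?expfz_neq0 ?mprod_neq0. Qed.

Definition monomial_exponent c : 'I_(r + u) -> int := comb (al c) (e c)%:Z.

(** On exponents congruent to [i] modulo [t], the torsion factor of [lam c ^+ k] is this
    constant. *)
Definition coset_coef (i : nat) c : F := w ^ (s c * i).

Let coset_coef0 i c : coset_coef i c != 0. Proof. by rewrite expfz_neq0. Qed.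

Definition coset_map i (x : 'I_(r + u) -> F) : 'M[F]_n :=
  \sum_c (coset_coef i c * mprod x (monomial_exponent c)) *: D c.

Definition power_point k : 'M[F]_n := \sum_c (lam c ^+ k * k%:R ^+ e c) *: D c.

Definition component i K :=
  zariski_closure [set power_point k | k in [set k | (K <= k)%N /\ k = i %[mod t]]].

Lemma coset_map_torus_point i k : k = i %[mod t] ->
  coset_map i (torus_point z k) = power_point k.
Proof.
move=> ki; apply: eq_bigr => c _; congr (_ *: _).
rewrite mprod_torus_point // mulrA; congr (_ * _).
rewrite /lam exprMn; congr (_ * _); rewrite /coset_coef.
rewrite exprnP exprz_exp !(prim_root_exprz_mod wt).
by rewrite -modzMmr -[in RHS]modzMmr !modz_nat ki.
Qed.

(** The points [torus_point k] already suffice; [k = 0] is left out because its last coordinate may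
    be zero. *)
Lemma mpoly_torus_eq0 (f : {mpoly F[r + u]}) : (forall x, T x -> f.@[x] = 0) -> f = 0.
Proof.
move=> f0; apply: (torus_point_dense z0 zi (t := 1) (i0 := 0) (K := 1)) => // l l0.
by apply: f0 => j; apply: torus_point_neq0; rewrite // add0n mul1n.
Qed.

Lemma laurent_entries (om : I -> F) (b : I -> 'I_(r + u) -> int) i j :
  laurent (fun x => (\sum_c (om c * mprod x (b c)) *: D c) i j).
Proof.
under eq_fun do rewrite summxE.
apply: laurent_sum => c; under eq_fun do rewrite mxE.
apply: laurentM; last exact: laurent_const.
by apply: laurentM; [exact: laurent_const|exact: laurent_mprod].
Qed.

(** A polynomial function vanishing on the points of one residue class pulls back to a Laurent
    polynomial on the torus, which is zero by [torus_point_dense]. *)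
Lemma componentE i K : (0 < K)%N -> component i K = zariski_closure (coset_map i @` T).
Proof.
move=> K0; apply/seteqP; split.
  apply: zariski_closureS => _ [k [Kk ki] <-]; exists (torus_point z k).
    by move=> j; apply: torus_point_neq0 => //; exact: leq_trans Kk.
  exact: coset_map_torus_point.
apply: zariski_closure_sub; first exact: closed_zariski_closure.
move=> _ [x xT <-]; apply/zariski_closureP => phi pphi h.
have [f [N fE]] := laurent_polyfun (laurent_entries (coset_coef i) monomial_exponent) pphi.
have f0 : f = 0.
  apply: (torus_point_dense z0 zi t0 (i0 := i) (K := K)) => l Kl.
  have k0 : (K <= i + t * l)%N.
    by rewrite (leq_trans Kl) // (leq_trans _ (leq_addl _ _)) // leq_pmull.
  have ki : (i + t * l = i %[mod t])%N by rewrite addnC mulnC modnMDl.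
  rewrite -fE; last by move=> j; apply: torus_point_neq0 => //; exact: leq_trans k0.
  rewrite -/(coset_map _ _) coset_map_torus_point // h ?mul0r //.
  by exists (i + t * l)%N.
have /eqP := fE x xT; rewrite f0 meval0 mulf_eq0 expf_eq0 => /orP[/eqP//|/andP[_]].
by move/prodf_eq0 => [j _]; rewrite (negbTE (xT j)).
Qed.

Lemma closed_component i K : zariski_closed (component i K).
Proof. exact: closed_zariski_closure. Qed.

Let ell_coset i x c : ell c (coset_map i x) = coset_coef i c * mprod x (monomial_exponent c).
Proof. exact: ellK. Qed.

(** Once the nonzero constants [coset_coef i c] are divided out, the functions [ell] and the
    matrices [D c] give inverse polynomial maps between the component and the toric model. *)
Lemma toric_component i K : (0 < K)%N -> toric_variety (component i K).
Proof.
move=> K0; split; first exact: closed_component.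
rewrite componentE //.
pose alpha : 'M[int]_(#|I|, r + u) := \matrix_(a, j) monomial_exponent (enum_val a) j.
exists #|I|, (r + u)%N, alpha.
pose f (A : 'M[F]_n) : 'rV[F]_#|I| :=
  \row_a ((coset_coef i (enum_val a))^-1 * ell (enum_val a) A).
pose g (y : 'rV[F]_#|I|) : 'M[F]_n := \sum_c (coset_coef i c * y 0 (enum_rank c)) *: D c.
have pf : polymap f.
  move=> a b; under eq_fun do rewrite mxE.
  by apply: polyfunM; [exact: polyfun_const|exact: ell_poly].
have pg : polymap g.
  move=> a b; under eq_fun do rewrite summxE.
  apply: polyfun_sum => c; under eq_fun do rewrite mxE.
  apply: polyfunM; last exact: polyfun_const.
  by apply: polyfunM; [exact: polyfun_const|exact: polyfun_entry].
have monE x : monomial_map alpha x = \row_a mprod (x 0) (monomial_exponent (enum_val a)).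
  by apply/rowP => a; rewrite !mxE; apply: eq_bigr => j _; rewrite mxE.
have fPhi x : f (coset_map i x) = monomial_map alpha (\row_j x j).
  rewrite monE; apply/rowP => a; rewrite !mxE ell_coset mulKf //.
  by congr (mprod _ _); apply/funext => j; rewrite mxE.
have gmon x : g (monomial_map alpha x) = coset_map i (x 0).
  by rewrite monE; apply: eq_bigr => c _; rewrite mxE enum_rankK.
have fg y : f (g y) = y.
  by apply/rowP => a; rewrite mxE ellK mulKf // enum_valK.
have [pF FE] := polymapP pf; have [pG GE] := polymapP pg.
exists pF, pG; rewrite FE GE; split=> //.
- apply: polymap_closure => // _ [x xT <-]; rewrite fPhi.
  by exists (\row_j x j) => // j; rewrite mxE; exact: xT.
- apply: polymap_closure => // _ [x xT <-]; rewrite gmon.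
  by exists (x 0).
(* This identity can fail off the span of the [D c], so it is checked on the image of the torus and
   extended to the closure as an equation. *)
- move=> A cA; apply/matrixP => a b; apply/eqP; rewrite -subr_eq0; apply/eqP.
  move/zariski_closureP: cA => /(_ (fun A => g (f A) a b - A a b)); apply.
    apply: polyfunD; first exact: (polyfun_comp pf (pg a b)).
    under eq_fun do rewrite -mulN1r.
    by apply: polyfunM; [exact: polyfun_const|exact: polyfun_entry].
  move=> _ [x xT <-]; rewrite fPhi gmon (_ : (\row_j x j) 0 = x) ?subrr //.
  by apply/funext => j; rewrite mxE.
Qed.

(** Separating positive from negative exponents turns a Laurent monomial in the coefficient
    functions into a polynomial identity, usable as an equation on closures. *)
Lemma monomial_ratio (b : I -> int) : exists U V, [/\ polyfun U, polyfun V &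
  forall A, (forall c, ell c A != 0) -> V A != 0 /\ U A = V A * mprod (ell ^~ A) b].
Proof.
exists (fun A => \prod_c ell c A ^+ (if 0 <= b c then `|b c|%N else 0)).
exists (fun A => \prod_c ell c A ^+ (if 0 <= b c then 0 else `|b c|%N)).
split; [by apply: polyfun_prod => c; exact: polyfunX|by apply: polyfun_prod => c; exact: polyfunX|].
move=> A A0; split; first by apply/prodf_neq0 => c _; rewrite expf_neq0.
rewrite -big_split; apply: eq_bigr => c _ /=; case: ifPn => [bc|]; last first.
  by rewrite -ltNge => bc; rewrite expr0 [X in X * _]exprnP -expfzDr // ltz0_abs // addNr expr0z.
by rewrite mul1r exprnP gez0_abs.
Qed.

(** The [t]-th power removes the torsion factors. *)
Lemma torsion_free_exponents k k' a a' :
  w ^ k * mprod z a = w ^ k' * mprod z a' -> a =1 a'.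
Proof.
move=> /(congr1 (fun y => y ^ (t : int))); rewrite !expfzMl !exprz_exp !(prim_root_exprzM wt).
rewrite !mul1r !mprodX => /(mul_indepP z0 zi) aa' j.
by apply: (mulIf (x := (t : int))); [rewrite eqz_nat -lt0n|exact: aa'].
Qed.

Let mprod_lam b : mprod lam b =
  w ^ (\sum_c s c * b c) * mprod z (fun j => \sum_c b c * al c j).
Proof.
rewrite mprodZ mprod_comp //; congr (_ * _).
rewrite (big_morph (fun k => w ^ k) (id1 := 1) (op1 := *%R)) ?expr0z //.
  by apply: eq_bigr => c _; rewrite exprz_exp.
by move=> k l; rewrite expfzDr.
Qed.

(** The support condition [e c = 0] ensures that the same product, taken over the coefficients of a
    power point, involves no factor [k]. *)
Hypotheses
  (gen_z : forall l, exists2 b : I -> int, forall c, b c != 0 -> e c = 0%N & mprod lam b = z l)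
  (gen_w : exists2 b : I -> int, forall c, b c != 0 -> e c = 0%N & mprod lam b = w)
  (gen_u : u -> exists c0 c1, [/\ lam c0 = lam c1, e c0 = 0%N & e c1 = 1%N]).

(** The exponent vectors generate the whole lattice, so every torus coordinate is, up to a constant,
    a Laurent monomial in the coefficients. The last coordinate comes from two indices with equal
    eigenvalue and powers 1 and 0 of [k]. *)
Lemma unit_exponent (l : 'I_(r + u)) :
  exists b, forall j, \sum_c b c * monomial_exponent c j = (j == l)%:Z.
Proof.
case: (split_ordP l) => l' ->.
  have [b be bz] := gen_z l'; exists b => j.
  have bal : (fun j => \sum_c b c * al c j) =1 (fun j => (j == l')%:Z).
    apply: (@torsion_free_exponents (\sum_c s c * b c) 0).
    by rewrite -mprod_lam bz mprod_delta mul1r.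
  case: (split_ordP j) => j' ->.
    by under eq_bigr do rewrite /monomial_exponent comb_lshift; rewrite bal eq_lshift.
  rewrite big1 ?eq_rlshift // => c _; rewrite /monomial_exponent comb_rshift.
  by have [->|/be ->] := eqVneq (b c) 0; rewrite ?mul0r ?mulr0.
have /gen_u[c0 [c1 [lam01 e0 e1]]] : u by case: (u) l' => // -[].
have al01 : al c0 =1 al c1 by exact: torsion_free_exponents lam01.
exists (fun c => (c == c1)%:Z - (c == c0)%:Z) => j.
have pick (a : I) (f : I -> int) : \sum_c (c == a)%:Z * f c = f a.
  rewrite (bigD1 a) //= eqxx mul1r big1 ?addr0 // => c /negbTE ->.
  by rewrite mul0r.
under eq_bigr do rewrite mulrBl; rewrite sumrB !pick /monomial_exponent.
case: (split_ordP j) => j' ->; first by rewrite !comb_lshift al01 subrr eq_lrshift.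
rewrite !comb_rshift e0 e1 eq_rshift.
suff -> : j' == l' by [].
by case: (u) j' l' => [|] j' l'; [rewrite (ord1 j') (ord1 l')|case: j'].
Qed.

(** Setting the coordinates from the [l]-th on to 1 leaves a subtorus of dimension [l]; the closures
    of the images form the chain that realizes the dimension. *)
Definition subtorus_map i l (x : 'I_(r + u) -> F) :=
  coset_map i (fun j => if (j < l)%N then x j else 1).

Let subtorus_mapE i l x : subtorus_map i l x = \sum_c (coset_coef i c *
  mprod x (fun j => if (j < l)%N then monomial_exponent c j else 0)) *: D c.
Proof.
apply: eq_bigr => c _; congr (_ * _ *: _); apply: eq_bigr => j _.
by case: ifP => _; rewrite ?exp1rz.
Qed.

Lemma subtorus_irreducible i l :
  irreducible_closed (zariski_closure (subtorus_map i l @` T)).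
Proof.
apply: irreducible_laurent_image mpoly_torus_eq0 => a b.
under eq_fun do rewrite subtorus_mapE.
exact: laurent_entries.
Qed.

(** For strictness, coordinate [l] is a ratio [U / V] of polynomial functions up to the constant
    [Om]; it equals 1 on the smaller image and takes other values on the larger one. *)
Lemma subtorus_chain i K : (0 < K)%N ->
  irreducible_chain (component i K) (r + u)
    (fun l => zariski_closure (subtorus_map i l @` T)).
Proof.
move=> K0; split=> [l _|l lru].
  split; first exact: subtorus_irreducible.
  rewrite componentE //; apply: zariski_closureS => _ [x xT <-].
  by eexists; [|reflexivity] => j; case: ifP => // _; exact: oner_neq0.
split.
  apply: zariski_closureS => _ [x xT <-].
  exists (fun j : 'I_(r + u) => if (j < l)%N then x j else 1); first by move=> j; case: ifP => // _; exact: oner_neq0.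
  congr (coset_map i _); apply/funext => j.
  by case: (ltnP j l) => jl; [rewrite ltnS (ltnW jl)|case: ifP].
move=> sub; have [b bl] := unit_exponent (Ordinal lru).
have [U [V [pU pV UV]]] := monomial_ratio b.
pose Om := mprod (coset_coef i) b.
have ell0 x c : (forall j, x j != 0) -> ell c (coset_map i x) != 0.
  by move=> x0; rewrite ell_coset mulf_neq0 // mprod_neq0.
have UE x : (forall j, x j != 0) -> U (coset_map i x) = V (coset_map i x) * (Om * x (Ordinal lru)).
  move=> x0; have [_ ->] := UV _ (fun c => ell0 x c x0); congr (_ * _).
  under [in LHS]eq_fun do rewrite ell_coset.
  rewrite mprodZ mprod_comp //; congr (_ * _).
  by rewrite -mprod_delta; congr (mprod x); apply/funext.
pose phi A := U A - V A * Om.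
have pphi : polyfun phi.
  apply: polyfunD => //; under eq_fun do rewrite -mulrN.
  by apply: polyfunM => //; exact: polyfun_const.
have pi0 k (x : 'I_(r + u) -> F) : T x -> T (fun j : 'I_(r + u) => if (j < k)%N then x j else 1).
  by move=> x0 j; case: ifP => // _; exact: oner_neq0.
have phi0 A : zariski_closure (subtorus_map i l @` T) A -> phi A = 0.
  move/zariski_closureP; apply=> // _ [x x0 <-].
  by rewrite /phi UE ?ltnn ?mulr1 ?subrr //; exact: pi0.
(* A point whose coordinate [l] is 2, which differs from 1. *)
pose x2 (j : 'I_(r + u)) : F := if j == Ordinal lru then 2%:R else 1.
have x20 : T x2 by move=> j; rewrite /x2; case: ifP => _; rewrite ?oner_neq0 // pnatr_eq0.
have := phi0 (subtorus_map i l.+1 x2); rewrite /phi UE; last exact: pi0.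
rewrite /= leqnn /x2 eqxx => h.
have /h : zariski_closure (subtorus_map i l @` T) (subtorus_map i l.+1 x2).
  by apply: sub; apply: sub_zariski_closure; exists x2.
rewrite -mulrBr mulr_natr -[X in _ - X]mulr1n -mulrnBr // => /eqP.
rewrite mulr1n mulf_eq0 (negbTE (mprod_neq0 _ _)) // orbF.
by have [/negbTE->] := UV (subtorus_map i l.+1 x2) (fun c => ell0 _ c (pi0 _ _ x20)).
Qed.

Lemma component_chain_le i K l c : (0 < K)%N ->
  irreducible_chain (component i K) l c -> (l <= r + u)%N.
Proof.
move=> K0; rewrite componentE //; apply: irreducible_chain_le.
exact: laurent_entries.
Qed.

Lemma has_dim_component i K : (0 < K)%N -> has_dim (component i K) (r + u).
Proof.
move=> K0; split; first by eexists; exact: subtorus_chain.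
by move=> l c; exact: component_chain_le.
Qed.

(** The top member of a chain is irreducible, so one component contains it and therefore the whole
    chain. *)
Lemma has_dim_components K : (0 < K)%N -> has_dim (\bigcup_(i : 'I_t) component i K) (r + u).
Proof.
move=> K0; split.
  have [irr sub] := subtorus_chain 0 K0.
  eexists; split; last exact: sub.
  move=> l /irr[h h']; split; first exact: h.
  by move=> A /h' cA; exists (Ordinal t0).
move=> l c ch; have [irr sub] := ch.
have [irrl cl] := irr l (leqnn l).
have [i cli] := irreducible_bigcup irrl (fun i : 'I_t => closed_component i K) cl.
apply: (@component_chain_le i K l c) => //; split=> // m ml.
split; first by case: (irr m ml).
apply: subset_trans cli => {irrl cl}.
elim: l ml sub {ch irr} => [|l IH]; first by rewrite leqn0 => /eqP -> _ A.
rewrite leq_eqVlt => /predU1P[-> _ A//|ml] sub; apply: (@subset_trans _ (c l)).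
  by apply: IH => // k kl; apply: sub; exact: leqW.
by have [] := sub l (leqnn _).
Qed.

(** By [gen_w], [w ^ k] is a ratio of polynomial functions of the power point; it is constantly
    [w ^ i] on the points of class [i], and these values are distinct for [i < t]. *)
Lemma component_inj K : (0 < K)%N -> injective (fun i : 'I_t => component i K).
Proof.
move=> K0 i j /= ij; have [b be bw] := gen_w.
have [U [V [pU pV UV]]] := monomial_ratio b.
have ell0 k c : (0 < k)%N -> ell c (power_point k) != 0.
  by move=> k0; rewrite ellK mulf_neq0 ?expf_neq0 // pnatr_eq0 -lt0n.
have UE k : (0 < k)%N -> U (power_point k) = V (power_point k) * w ^+ k.
  move=> k0; have [_ ->] := UV _ (fun c => ell0 k c k0); congr (_ * _).
  rewrite -bw [RHS]exprnP mprodX; apply: eq_bigr => c _; rewrite ellK.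
  have [->|/be ->] := eqVneq (b c) 0; first by rewrite mul0r !expr0z.
  by rewrite expr0 mulr1 exprnP exprz_exp mulrC.
pose phi A := U A - V A * w ^+ i.
have pphi : polyfun phi.
  apply: polyfunD => //; under eq_fun do rewrite -mulrN.
  by apply: polyfunM => //; exact: polyfun_const.
have phi0 A : component i K A -> phi A = 0.
  move/zariski_closureP; apply=> // _ [k [Kk ki] <-].
  rewrite /phi UE ?(leq_trans K0) // -(prim_expr_mod wt k) ki (prim_expr_mod wt).
  by rewrite subrr.
pose k := (j + t * K)%N.
have kK : (K <= k)%N by rewrite (leq_trans _ (leq_addl _ _)) // leq_pmull.
have k0 : (0 < k)%N by exact: leq_trans kK.
have kj : k = j %[mod t] by rewrite /k addnC mulnC modnMDl.
have /phi0/eqP : component i K (power_point k).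
  by rewrite ij; apply: sub_zariski_closure; exists k.
rewrite /phi UE // -(prim_expr_mod wt k) kj (prim_expr_mod wt) -mulrBr mulf_eq0.
have [/negbTE -> _] := UV (power_point k) (fun c => ell0 k c k0).
rewrite subr_eq0 (eq_prim_root_expr wt) !modn_small // => /eqP ji.
exact/val_inj/esym.
Qed.

End Components.

(** * Closure of the semigroup of powers *)

Section PowerSemigroup.
Context {F : numClosedFieldType} (n : nat) (M : 'M[F]_n).
Let nu := max_jordan_size M 0.

(** If [M^k = M^l] with [k < l <= nu], multiplying by the power [nu.-1 - k] of [M] raises the second
    exponent to at least [nu], which kills [v], whereas the first becomes [nu.-1]. *)
Lemma power_inj (v : 'rV[F]_n) : v *m M ^+ nu = 0 -> v *m M ^+ nu.-1 != 0 ->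
  forall k l, (k <= nu)%N -> (l <= nu)%N -> M ^+ k = M ^+ l -> k = l.
Proof.
move=> v0 v1.
suff H k l : (k < l)%N -> (l <= nu)%N -> M ^+ k = M ^+ l -> False.
  move=> k l kn ln e; have [kl|lk|//] := ltngtP k l; first by case: (H k l).
  by case: (H l k).
move=> kl ln e; move/eqP: v1; apply.
have -> : nu.-1 = (k + (nu.-1 - k))%N by lia.
rewrite exprD e -exprD (_ : l + _ = nu + (l - k).-1)%N; last by lia.
by rewrite exprD -mulmxE mulmxA v0 mul0mx.
Qed.

Definition initial_powers m : set 'M[F]_n := [set M ^+ i.+1 | i in `I_m].

Lemma closed_initial_powers m : zariski_closed (initial_powers m).
Proof.
have -> : initial_powers m = \bigcup_(i : 'I_m) [set M ^+ i.+1].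
  apply/seteqP; split=> A; first by move=> [i im <-]; exists (Ordinal im).
  by move=> [i _ ->]; exists i => //=.
by apply: zariski_closed_bigcup => i; exact: zariski_closed1.
Qed.

(** Each generator of the group occurs as some [lam c] with [e c = 0], and products and inverses
    preserve the support condition. *)
Lemma exponents_supported (I : finType) (lam : I -> F) (e : I -> nat) :
  (forall c, lam c != 0) ->
  (forall a, nonzero_eigenvalues M a -> exists2 c, lam c = a & e c = 0%N) ->
  forall y, eigenvalue_group M y ->
  exists2 b : I -> int, forall c, b c != 0 -> e c = 0%N & mprod lam b = y.
Proof.
move=> lam0 El y.
move/(_ [set y | exists2 b : I -> int, forall c, b c != 0 -> e c = 0%N & mprod lam b = y]).
apply; split; last first.
  move=> a /El[c <- ec]; exists (fun j => (j == c)%:Z); last exact: mprod_delta.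
  by move=> c'; case: (c' =P c) => [->|].
split.
- by exists (fun=> 0); [move=> c; rewrite eqxx|exact: mprod0].
- by move=> _ [b _ <-]; exact: mprod_neq0.
- move=> _ _ [b be <-] [b' be' <-]; exists (fun c => b c + b' c); last exact: mprodD.
  move=> c; have [->|/be //] := eqVneq (b c) 0; rewrite add0r; exact: be'.
- move=> _ [b be <-]; exists (fun c => b c * -1); last by rewrite -mprodX.
  by move=> c; rewrite mulrN1 oppr_eq0; exact: be.
Qed.

End PowerSemigroup.

Unset Implicit Arguments.

Theorem theorem2 (R : realType) (n : nat) (M : 'M[R[i]]_n) (hM : M != 0) :
  let nu := max_jordan_size M 0 in
  let E := nonzero_eigenvalues M in
  let G := eigenvalue_group M in
  exists X0 X1 : set 'M[R[i]]_n,
    [/\ zariski_closure (power_semigroup M) = X0 `|` X1,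
        X0 `&` X1 = set0,
        zariski_closed X0 /\ zariski_closed X1,
        X0 #= `I_(if `[< E = set0 >] then nu else maxn 0 (nu - 1)) &
        (X1 = set0 /\ E = set0) \/
        (E !=set0 /\
         exists (t r d : nat) (Z : 'I_t -> set 'M[R[i]]_n),
           [/\ torsion G #= `I_t /\ group_rank G r,
               d = if `[< diagonalizable (M ^+ maxn 1 nu) >] then r else r.+1,
               injective Z /\ X1 = \bigcup_i Z i,
               forall i, toric_variety (Z i) /\ has_dim (Z i) d &
               has_dim X1 d])].
Proof.
move=> nu E G.
have [I [lam [e [D [ell [[ellp ellK] MX [lamE Elam] diagE]]]]]] := power_expansion M.
have [m [B MB]] := jordan_dec_exists M.
have [v [v0 v1]] := nilpotent_vector MB.
have lam0 c : lam c != 0 by case: (lamE c).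
(* The isolated points are [M^1, ..., M^(nu-1)], together with [M^nu = 0] in the nilpotent case. *)
pose m0 := if `[< E = set0 >] then nu else maxn 0 (nu - 1).
have m0nu : (m0 <= nu)%N by rewrite /m0; case: ifP => // _; rewrite max0n leq_subr.
have X0card : initial_powers M m0 #= `I_m0.
  apply: inj_card_eq => i j; rewrite !inE /= => im jm ij.
  have nu0 : (0 < nu)%N by exact: leq_trans (leq_ltn_trans _ im) m0nu.
  by have [] := power_inj v0 (v1 nu0) (leq_trans im m0nu) (leq_trans jm m0nu) ij.
have [E0|nE0] := pselect (E = set0).
  have MX0 k : (nu <= k)%N -> M ^+ k = 0.
    move=> /MX ->; rewrite big1 // => c _; have := lamE c.
    by rewrite -/E E0.
  have m0E : m0 = nu by rewrite /m0 asboolT.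
  have nu0 : (0 < nu)%N.
    by rewrite lt0n; apply: contraNneq hM => nu0; rewrite -[M]expr1 MX0 ?nu0.
  exists (initial_powers M m0), set0; split=> //.
  - rewrite setU0 -[RHS](zariski_closure_id (closed_initial_powers M m0)); congr zariski_closure.
    apply/seteqP; split=> [_ [k k0 <-]|_ [i im <-]]; last by exists i.+1.
    have [kn|nk] := leqP k nu; first by exists k.-1; rewrite ?prednK //= m0E prednK.
    by exists nu.-1; rewrite ?prednK //= ?m0E ?prednK // !MX0 // ltnW.
  - by rewrite setI0.
  - by split; [exact: closed_initial_powers|exact: zariski_closed0].
  - by left.
have m0E : m0 = (nu - 1)%N by rewrite /m0 asboolF ?max0n.
have E0 : E !=set0 by exact/set0P/eqP.
(* The expansion of [M^k] holds from [nu] on, but the semigroup has no zeroth power. *)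
pose K := maxn 1 nu.
have K0 : (0 < K)%N by rewrite leq_max.
pose x (i : 'I_#|I|) := lam (enum_val i).
have GE : G = range (mprod x).
  apply: smallest_mul_subgroup => [i||i]; [exact: lam0| |exact: lamE].
  move=> a /Elam[c <- _]; exists (fun j => (j == enum_rank c)%:Z) => //.
  by rewrite mprod_delta /x enum_rankK.
have [t [w [r [z [wt z0 zi yz]]]]] := mprod_structure (x := x) (fun i => lam0 _).
have GP y : G y <-> exists k b, y = w ^ k * mprod z b by rewrite GE.
have GH : forall y, G y -> exists2 b : I -> int, forall c, b c != 0 -> e c = 0%N & mprod lam b = y.
  exact: exponents_supported.
have lamG c : G (lam c) by move=> H [_ ]; apply; exact: lamE.
have [s sE] := choice (fun c => (GP _).1 (lamG c)).
have [al alE] := choice sE.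
have {}lamE' : lam = fun c => w ^ s c * mprod z (al c) by apply/funext.
pose u := ~~ `[< diagonalizable (M ^+ maxn 1 nu) >].
have eu c : (e c == 0)%N || u.
  by move: diagE; rewrite /u; case: asbool => [->|]; rewrite ?orbT.
have gz l : exists2 b : I -> int, forall c, b c != 0 -> e c = 0%N &
    mprod (fun c => w ^ s c * mprod z (al c)) b = z l.
  rewrite -lamE'; apply/GH/GP; exists 0, (fun j => (j == l)%:Z).
  by rewrite mprod_delta mul1r.
have gw : exists2 b : I -> int, forall c, b c != 0 -> e c = 0%N &
    mprod (fun c => w ^ s c * mprod z (al c)) b = w.
  rewrite -lamE'; apply/GH/GP; exists 1, (fun=> 0).
  by rewrite mprod0 mulr1 expr1z.
have gu : u -> exists c0 c1, [/\ w ^ s c0 * mprod z (al c0) = w ^ s c1 * mprod z (al c1),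
    e c0 = 0%N & e c1 = 1%N].
  move: diagE; rewrite /u; case: asbool => //= -[c0 [c1 [l01 e0 e1]]] _.
  by exists c0, c1; split=> //; rewrite -!alE.
have PP k : (nu <= k)%N -> power_point e D w z s al k = M ^+ k.
  by move=> /MX ->; rewrite lamE'.
pose Z (i : 'I_t) := component e D t w z s al i K.
have t0 := prim_order_gt0 wt.
(* The powers from [K] on are sorted into residue classes modulo [t]. *)
have X1E : zariski_closure [set M ^+ k | k in [set k | (K <= k)%N]] = \bigcup_i Z i.
  apply/seteqP; split.
    apply: zariski_closure_sub.
      by apply: zariski_closed_bigcup => i; exact: closed_component.
    move=> _ [k Kk <-]; exists (Ordinal (ltn_pmod k t0)) => //.
    apply: sub_zariski_closure; exists k; first by rewrite /= modn_mod.
    by apply: PP; apply: leq_trans Kk; rewrite leq_maxr.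
  move=> A [i _]; apply: zariski_closureS => _ [k [Kk _] <-]; exists k => //.
  by rewrite PP //; apply: leq_trans Kk; rewrite leq_maxr.
exists (initial_powers M m0), (\bigcup_i Z i); split=> //.
- rewrite -X1E -(zariski_closure_id (closed_initial_powers M m0)) -zariski_closureU.
  congr zariski_closure; apply/seteqP; split=> [_ [k k0 <-]|A].
    have [kn|nk] := ltnP k nu; [left|right]; last by exists k; rewrite //= geq_max k0.
    by exists k.-1; rewrite ?prednK //= m0E; move: k0 => /=; lia.
  by case=> [[i _ <-]|[k Kk <-]]; [exists i.+1|exists k => //; exact: leq_trans K0 Kk].
(* The equation [v A = 0] holds on the closure of the powers from [K] on, but not at [M^(i+1)] with
   [i + 1 < nu]. *)
- apply/seteqP; split=> // A [[i im <-]]; rewrite -X1E => cA.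
  have nu1 : (i.+1 < nu)%N by move: im; rewrite /= m0E; lia.
  have vA : v *m M ^+ i.+1 = 0.
    apply/rowP => j; rewrite [RHS]mxE.
    move/zariski_closureP: cA => /(_ (fun A => (v *m A) 0 j)); apply.
      under eq_fun do rewrite mxE.
      by apply: polyfun_sum => l; apply: polyfunM; [exact: polyfun_const|exact: polyfun_entry].
    move=> _ [k Kk <-]; have nuk : (nu <= k)%N by apply: leq_trans Kk; rewrite leq_maxr.
    by rewrite -(subnKC nuk) exprD -mulmxE mulmxA v0 mul0mx mxE.
  have /eqP := v1 (leq_trans (ltn0Sn _) (ltnW nu1)); apply.
  rewrite -/nu (_ : nu.-1 = i.+1 + (nu.-1 - i.+1))%N; last by lia.
  by rewrite exprD -mulmxE mulmxA vA mul0mx.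
- split; first exact: closed_initial_powers.
  by rewrite -X1E; exact: closed_zariski_closure.
- right; split=> //; exists t, r, (r + u)%N, Z; split.
  + split; first exact: (torsion_card wt zi GP).
    exact: (group_rank_free wt z0 zi GP).
  + by rewrite /u; case: asbool; rewrite ?addn0 ?addn1.
  + by split=> //; exact: (component_inj ellp ellK wt z0 gw K0).
  + move=> i; split; first exact: (toric_component ellp ellK wt z0 zi s al eu).
    exact: (has_dim_component ellp ellK wt z0 zi eu gz gu).
  + exact: (has_dim_components ellp ellK wt z0 zi eu gz gu K0).
Qed.
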